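(* There exist absolute constants $c>0$ and $C\ge 1$ such that the following holds for every positive integer $n$, every prime $p$ with $2<p\le\exp(cn^{1/4})$ and every fixed $\lambda\in\mathbb{F}_p$. Let $m=\lceil C\log p\rceil$ and let $M_n$ be an $n\times n$ random symmetric Rademacher matrix. With probability at least $1-\exp(-n/9)$, every nonzero vector $\boldsymbol{v}=(v_1,\dots,v_n)\in\mathbb{F}_p^n$ that is orthogonal (over $\mathbb{F}_p$) to at least $n-n/\log p$ rows of $M_n-\lambda I_n$ has the following property: for every set $T\subseteq[n]$ of size $\lfloor n/4\rfloor$, there are at least $n/(2m)$ pairwise disjoint sets $S\subseteq[n]\setminus T$ of size $m$ such that $$\operatorname{disc}_{\mathbb{F}_p}(\boldsymbol{v}|_S)\le\frac{C}{p^2}.$$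
   Context: An $n\times n$ random symmetric Rademacher matrix $M_n$ is a random symmetric matrix whose entries on and above the diagonal are i.i.d. Rademacher random variables, i.e. each equals $+1$ or $-1$ with probability $1/2$ each; entries are reduced modulo $p$ so that $M_n-\lambda I_n$ is a matrix over $\mathbb{F}_p$. $\log$ is the natural logarithm and $[n]=\{1,\dots,n\}$. A vector is orthogonal to a row $R$ if their dot product is $0$ in $\mathbb{F}_p$. For $S\subseteq[n]$, $\boldsymbol{v}|_S$ denotes the restriction of $\boldsymbol{v}$ to the coordinates in $S$, and $$\operatorname{disc}_{\mathbb{F}_p}(\boldsymbol{v}|_S)=\sup_{x\in\mathbb{F}_p}\bigg|\mathbb{P}_\xi\bigg[\sum_{i\in S}\xi_iv_i=x\bigg]-\frac1p\bigg|,$$ where $(\xi_i)_{i\in S}$ are i.i.d. Rademacher random variables (with values $\pm1$ regarded in $\mathbb{F}_p$). *)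

(* Defs.v *)
From HB Require Import structures.
From mathcomp Require Import all_boot all_order all_algebra.
From mathcomp Require Import all_classical all_reals all_analysis.
Set Implicit Arguments.
Unset Strict Implicit.
Unset Printing Implicit Defensive.
Import Order.TTheory GRing.Theory Num.Theory.
Local Open Scope classical_set_scope.
Local Open Scope ring_scope.

Definition rademacher (b : bool) : int := (-1) ^+ b.

(* The law of a family of i.i.d. fair coins indexed by [I]: the product of the
   laws giving weight 1/2 to each of the two outcomes. *)
Definition Pr (R : realType) (I : finType) (E : set {ffun I -> bool}) : R :=
  \sum_(xi : {ffun I -> bool} | xi \in E) \prod_(i : I) (2^-1 : R).

(* Positions on and above the diagonal of an n x n matrix. *)
Definition upper (n : nat) := {ij : 'I_n * 'I_n | (ij.1 <= ij.2)%N}.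

Fact sort_pair_subproof (n : nat) (i j : 'I_n) :
  let ij := if (i <= j)%N then (i, j) else (j, i) in (ij.1 <= ij.2)%N.
Proof. by case: (leqP i j) => //= /ltnW. Qed.

Definition sort_pair (n : nat) (i j : 'I_n) : upper n :=
  exist _ (if (i <= j)%N then (i, j) else (j, i)) (sort_pair_subproof i j).

Definition sym_rademacher_mx (n : nat) (xi : {ffun upper n -> bool}) :
    'M[int]_n :=
  \matrix_(i < n, j < n) rademacher (xi (sort_pair i j)).

Definition disc (R : realType) (p : nat) (I : finType) (w : I -> 'F_p) : R :=
  sup (range (fun x : 'F_p =>
    `| Pr R [set xi : {ffun I -> bool} |
              \sum_(i : I) (rademacher (xi i))%:~R * w i = x]
       - p%:R^-1 |)).

Definition restr (A : Type) (n : nat) (v : 'cV[A]_n) (S : {set 'I_n}) :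
    {i : 'I_n | i \in S} -> A :=
  fun i => v (val i) 0.
Arguments restr {A n} v S i.

Definition orth_rows (p n : nat) (A : 'M['F_p]_n) (v : 'cV['F_p]_n) :
    {set 'I_n} :=
  [set i : 'I_n | row i A *m v == 0]%SET.

(* Main.v *)
Require Import Defs.
From HB Require Import structures.
From mathcomp Require Import all_boot all_order all_algebra.
From mathcomp Require Import ring lra zify.
From mathcomp Require Import all_classical all_reals all_analysis.
Set Implicit Arguments.
Unset Strict Implicit.
Unset Printing Implicit Defensive.
Import Order.TTheory GRing.Theory Num.Theory.
Local Open Scope classical_set_scope.
Local Open Scope ring_scope.

(** Write e(z) = cos(2 pi z / p). Averaging over the entries (i, j), j in J, of
the rows i outside J, Fourier inversion bounds the probability that a vector v is
orthogonal to a set O of rows by r ^ #|O \ J|, where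
r = p^-1 * sum_t prod_(j in J) |e(t v_j)|.

The set J is built greedily: a coordinate is added as long as this multiplies r by
at most 1 - tau^2, for a small constant tau. As r >= 1/p this stops after fewer
than m = O(log p) steps, and then every other coordinate of v lies in the Bohr ball
{x : sum_t w(t) |sin(2 pi t x / p)| <= 2 tau sum_t w(t)} of the weight
w(t) = prod_(j in J) |e(t v_j)|, which depends only on the restriction of v to J.
By Parseval a larger ball has at most 4 / r elements, and a ball with a nonzero
element grows linearly with its radius, so this ball is {0} or has at most eps / r
elements, provided r > 4 / p. In the second case the number of such v compensates
r ^ n; in the first one v is supported on J, and J = {j} with v_j <> 0 gives the
bound (3/4) ^ n, which beats the number of sparse vectors.

There remain the vectors with r <= 4 / p. If v violates the conclusion, a maximal
disjoint family leaves a set U of at least n/4 coordinates all of whose m-subsets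
have large discrepancy. The same greedy argument inside U, with t = 0 removed from
the sum, forces most coordinates of U into a ball of at most eps p elements, so
there are at most (eps' p) ^ n such v, against a probability (O(1) / p) ^ n. *)

(** * Cosine and sine of 2 pi x / p as functions on F_p *)

Section Characters.
Variables (R : realType) (p : nat).
Hypothesis p_pr : prime p.
Implicit Types (x y z : 'F_p).

Definition angle x : R := (val x)%:R / p%:R * (pi *+ 2).
Definition cosp x := cos (angle x).
Definition sinp x := sin (angle x).

Let p_neq0 : p%:R != 0 :> R.
Proof. by rewrite pnatr_eq0 -lt0n prime_gt0. Qed.

Lemma angleD x y : exists n : nat, angle x + angle y = angle (x + y) + pi *+ 2 *+ n.
Proof.
(* Addition in F_p reduces modulo p; the quotient counts the full turns lost. *)
exists ((val x + val y) %/ p)%N.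
have -> : angle (x + y) = ((val x + val y) %% p)%:R / p%:R * (pi *+ 2).
  by rewrite /angle /= [in X in (_ %% X)%N]Fp_cast.
rewrite /angle -!mulrDl -natrD {1}(divn_eq (val x + val y) p) natrD natrM.
by rewrite !mulrDl mulfK// -(mulr_natl (pi *+ 2)) addrC.
Qed.

Lemma cospD x y : cosp (x + y) = cosp x * cosp y - sinp x * sinp y.
Proof.
have [n e] := angleD x y.
by rewrite /cosp /sinp -cosD e (periodicn (@cosD2pi R)).
Qed.

Lemma sinpD x y : sinp (x + y) = sinp x * cosp y + cosp x * sinp y.
Proof.
have [n e] := angleD x y.
by rewrite /cosp /sinp -sinD e (periodicn (@sinD2pi R)).
Qed.

Lemma cosp0 : cosp 0 = 1.
Proof. by rewrite /cosp /angle /= mul0r mul0r cos0. Qed.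

Lemma sinp0 : sinp 0 = 0.
Proof. by rewrite /sinp /angle /= mul0r mul0r sin0. Qed.

Lemma cosp2Dsinp2 x : cosp x ^+ 2 + sinp x ^+ 2 = 1.
Proof. exact: cos2Dsin2. Qed.

(** As [angle (- x)] is not [- angle x], parity is extracted from the addition formulas at - x + x =
    0, a linear system in the cosine and sine of - x, solved with cos^2 + sin^2 = 1. *)
Lemma cospN x : cosp (- x) = cosp x.
Proof.
have h1 := cospD (- x) x; have h2 := sinpD (- x) x.
rewrite addNr cosp0 in h1; rewrite addNr sinp0 in h2.
have -> : cosp (- x) = cosp (- x) * (cosp x ^+ 2 + sinp x ^+ 2).
  by rewrite cosp2Dsinp2 mulr1.
transitivity (cosp x * 1 + sinp x * 0); last by ring.
by rewrite h1 h2; ring.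
Qed.

Lemma sinpN x : sinp (- x) = - sinp x.
Proof.
have h1 := cospD (- x) x; have h2 := sinpD (- x) x.
rewrite addNr cosp0 in h1; rewrite addNr sinp0 in h2.
have -> : sinp (- x) = sinp (- x) * (cosp x ^+ 2 + sinp x ^+ 2).
  by rewrite cosp2Dsinp2 mulr1.
transitivity (cosp x * 0 - sinp x * 1); last by ring.
by rewrite h1 h2; ring.
Qed.

Lemma cosp_le1 x : `|cosp x| <= 1. Proof. exact: cos_max. Qed.

Lemma cospDB x y : cosp (x + y) + cosp (x - y) = 2 * (cosp x * cosp y).
Proof. by rewrite !cospD cospN sinpN; ring. Qed.

Lemma cospDx x : cosp (x + x) = 1 - 2 * sinp x ^+ 2.
Proof. by rewrite cospD; have := cosp2Dsinp2 x; lra. Qed.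

Lemma normr_sinpD x y : `|sinp (x + y)| <= `|sinp x| + `|sinp y|.
Proof.
rewrite sinpD (le_trans (ler_normD _ _))// !normrM lerD//.
  by rewrite ler_piMr// cosp_le1.
by rewrite ler_piMl// cosp_le1.
Qed.

Lemma cosp1_neq1 : cosp 1 != 1.
Proof.
have p1 := prime_gt1 p_pr.
have a1 : angle 1 = (pi *+ 2) / p%:R.
  have -> : angle 1 = (val (1 : 'F_p))%:R / p%:R * (pi *+ 2) by [].
  have -> : val (1 : 'F_p) = 1%N.
    by [].
  by rewrite mul1r mulrC.
apply/eqP => c1.
suff : angle 1 = 0.
  rewrite a1 => /eqP; rewrite mulf_eq0 invr_eq0 (negbTE p_neq0) orbF mulrn_eq0/=.
  by rewrite gt_eqF// pi_gt0.
apply: cos_inj; last by rewrite cos0.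
- have pi0 : 0 <= (pi : R) := @pi_ge0 R.
  rewrite a1; move: (pi : R) pi0 => q pi0; rewrite in_itv/=; apply/andP; split.
    by apply: divr_ge0 => //; exact: mulrn_wge0.
  rewrite ler_pdivrMr ?ltr0n ?prime_gt0// -(mulr_natr q 2).
  by apply: ler_wpM2l => //; rewrite ler_nat.
- by rewrite in_itv/= lexx pi_ge0.
Qed.

(** For z <> 0, reindexing reduces to z = 1. The sine sum vanishes by oddness, so translation by 1
    multiplies the cosine sum by cos (2 pi / p), which differs from 1. *)
Lemma sum_cosp z : \sum_(t : 'F_p) cosp (t * z) = if z == 0 then p%:R else 0.
Proof.
have [->|z0] := eqVneq z 0.
  under eq_bigr do rewrite mulr0 cosp0.
  by rewrite sumr_const card_Fp.
have bz : {on [pred _ | true], bijective (fun t : 'F_p => t * z)}.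
  by apply: onW_bij; exists (fun t => t / z) => t; rewrite ?mulfK ?divfK.
rewrite -(reindex _ bz (F := cosp))/=.
set E := (X in X = 0).
have S0 : \sum_t sinp t = 0 :> R.
  suff : \sum_t sinp t = - \sum_t sinp t by lra.
  rewrite -[RHS]sumrN (reindex_inj oppr_inj)/=.
  by apply: eq_bigr => t _; rewrite sinpN.
have E1 : E = E * cosp 1.
  rewrite {1}/E (reindex_inj (addIr 1))/=.
  under eq_bigr do rewrite cospD.
  by rewrite sumrB -!mulr_suml S0 mul0r subr0.
apply/eqP; have : E * (1 - cosp 1) = 0 by rewrite mulrBr mulr1 -E1 subrr.
move/eqP; rewrite mulf_eq0 => /orP[//|]; rewrite subr_eq0 eq_sym.
by rewrite (negbTE cosp1_neq1).
Qed.

Lemma indicator_cosp z : (z == 0)%:R = p%:R^-1 * \sum_(t : 'F_p) cosp (t * z).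
Proof. by rewrite sum_cosp; case: eqP => _; rewrite ?mulVf ?mulr0. Qed.

End Characters.

(** * Fourier analysis of sums of independent signs *)

Section RademacherSums.
Variables (R : realType) (p : nat).
Hypothesis p_pr : prime p.

(** Flipping one coin preserves the uniform measure, so a coin is averaged out by pairing each
    outcome with its flip. *)
Definition flip (K : finType) (k : K) (xi : {ffun K -> bool}) :=
  [ffun i => xi i (+) (i == k)].

Lemma flipK (K : finType) (k : K) : involutive (flip k).
Proof. by move=> xi; apply/ffunP => i; rewrite !ffunE -addbA addbb addbF. Qed.

Lemma flipE (K : finType) (k : K) xi : flip k xi k = ~~ xi k.
Proof. by rewrite ffunE eqxx addbT. Qed.

Lemma flip_neq (K : finType) (k i : K) xi : i != k -> flip k xi i = xi i.
Proof. by rewrite ffunE => /negbTE ->; rewrite addbF. Qed.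

(** The coins of J are removed one by one, through cos (z + a) + cos (z - a) = 2 cos z cos a. The
    map [c] lets J be a set of columns whose coins are the entries of one row. *)
Lemma sum_flip_cosp (K T : finType) (c : T -> K) (J : {set T})
    (F : {ffun K -> bool} -> R) (z : {ffun K -> bool} -> 'F_p) (a : T -> 'F_p) :
  {in J &, injective c} ->
  (forall j xi, j \in J -> F (flip (c j) xi) = F xi) ->
  (forall j xi, j \in J -> z (flip (c j) xi) = z xi) ->
  \sum_xi F xi * cosp R (z xi + \sum_(j in J) (-1) ^+ xi (c j) * a j) =
  (\sum_xi F xi * cosp R (z xi)) * \prod_(j in J) cosp R (a j).
Proof.
elim: {J}_.+1 {-2}J (ltnSn #|J|) z => // k IH J leJ z injc Fi zi.
have [->|[j jJ]] := set_0Vmem J.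
  rewrite big_set0 mulr1; apply: eq_bigr => xi _.
  by rewrite big_set0 addr0.
rewrite [in RHS](big_setD1 j)//=.
under eq_bigr do rewrite (big_setD1 j)//= addrA.
rewrite (IH (J :\ j)%SET _ (fun xi => z xi + (-1) ^+ xi (c j) * a j)).
- rewrite mulrA; congr (_ * _).
  pose S := \sum_xi F xi * cosp R (z xi + (-1) ^+ xi (c j) * a j).
  have S1 : S = \sum_xi F xi * cosp R (z xi + (-1) ^+ (~~ xi (c j)) * a j).
    rewrite /S (reindex_inj (can_inj (flipK (c j))))/=.
    by apply: eq_bigr => xi _; rewrite flipE Fi// zi.
  have S2 : S + S = 2 * ((\sum_xi F xi * cosp R (z xi)) * cosp R (a j)).
    rewrite {2}S1 -big_split/= mulr_suml mulr_sumr; apply: eq_bigr => xi _.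
    rewrite -mulrDr.
    transitivity (F xi * (2 * (cosp R (z xi) * cosp R (a j)))); last by ring.
    rewrite -cospDB//; congr (_ * _).
    by case: (xi (c j)); rewrite /= ?expr1 ?expr0 ?mulN1r ?mul1r// addrC.
  by rewrite -/S; lra.
- by rewrite ltnS in leJ; apply: leq_trans leJ; rewrite [X in (_ < X)%N](cardsD1 j) jJ.
- by move=> x y /setD1P[_ xJ] /setD1P[_ yJ]; exact: injc.
- by move=> i xi /setD1P[_ iJ]; exact: Fi.
- move=> i xi /setD1P[ij iJ]; rewrite zi// flip_neq//.
  by apply: contra_neq ij => /injc ->.
Qed.

(** Fourier inversion, then averaging over the coins of J. The factor F stands for an event on the
    other coins, so that the bound can be iterated row by row. *)
Lemma sum_flip_eq0_le (K T : finType) (c : T -> K) (J : {set T})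
    (F : {ffun K -> bool} -> R) (z : {ffun K -> bool} -> 'F_p) (a : T -> 'F_p) :
  {in J &, injective c} ->
  (forall j xi, j \in J -> F (flip (c j) xi) = F xi) ->
  (forall j xi, j \in J -> z (flip (c j) xi) = z xi) ->
  (forall xi, 0 <= F xi) ->
  \sum_xi F xi * (z xi + \sum_(j in J) (-1) ^+ xi (c j) * a j == 0)%:R <=
  (\sum_xi F xi) *
  (p%:R^-1 * \sum_(t : 'F_p) \prod_(j in J) `|cosp R (t * a j)|).
Proof.
move=> injc Fi zi F0.
have -> : \sum_xi F xi * (z xi + \sum_(j in J) (-1) ^+ xi (c j) * a j == 0)%:R
  = p%:R^-1 * \sum_(t : 'F_p)
      (\sum_xi F xi * cosp R (t * z xi)) * \prod_(j in J) cosp R (t * a j).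
  transitivity (p%:R^-1 * \sum_(t : 'F_p) \sum_xi F xi * cosp R
    (t * z xi + \sum_(j in J) (-1) ^+ xi (c j) * (t * a j))).
    rewrite exchange_big mulr_sumr/=; apply: eq_bigr => xi _.
    rewrite (indicator_cosp R p_pr) mulrCA; congr (_ * _); rewrite mulr_sumr.
    apply: eq_bigr => t _; congr (_ * cosp R _); rewrite mulrDr mulr_sumr.
    by congr (_ + _); apply: eq_bigr => j _; rewrite mulrCA.
  congr (_ * _); apply: eq_bigr => t _.
  by apply: sum_flip_cosp => // j xi jJ; rewrite zi.
rewrite mulrCA ler_wpM2l ?invr_ge0// mulr_sumr; apply: ler_sum => t _.
apply: le_trans (ler_norm _) _; rewrite normrM normr_prod ler_wpM2r//.
  by apply: prodr_ge0.
apply: le_trans (ler_norm_sum _ _ _) _; apply: ler_sum => xi _.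
by rewrite normrM ger0_norm// ler_piMr// cosp_le1.
Qed.

Lemma PrE (I : finType) (E : set {ffun I -> bool}) :
  Pr R E = (2^-1) ^+ #|I| * \sum_xi (xi \in E)%:R.
Proof.
rewrite /Pr big_mkcond/= mulr_sumr; apply: eq_bigr => xi _.
by rewrite prodr_const; case: (xi \in E); rewrite ?mulr1 ?mulr0.
Qed.

Lemma sum_coins (I : finType) :
  (2^-1) ^+ #|I| * \sum_(xi : {ffun I -> bool}) 1 = 1 :> R.
Proof.
rewrite sumr_const card_ffun card_bool -mulr_natr mul1r natrX -exprMn.
by rewrite mulVf ?expr1n// pnatr_eq0.
Qed.

Lemma rademacher_Fp (b : bool) : (rademacher b)%:~R = (-1) ^+ b :> 'F_p.
Proof. by case: b; rewrite /rademacher /= ?expr1 ?expr0 ?rmorphN ?rmorph1. Qed.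

(** In the Fourier expansion of a point probability, the frequency 0 contributes exactly 1/p, which
    cancels. *)
Lemma disc_le (I : finType) (w : I -> 'F_p) :
  disc R w <= p%:R^-1 * \sum_(t : 'F_p | t != 0) \prod_(i : I) `|cosp R (t * w i)|.
Proof.
apply: ge_sup; first by exists (`| Pr R [set xi : {ffun I -> bool} |
  \sum_(i : I) (rademacher (xi i))%:~R * w i = 0] - p%:R^-1 |); exists 0.
move=> _ [x _ <-].
have -> : Pr R [set xi : {ffun I -> bool} |
    \sum_(i : I) (rademacher (xi i))%:~R * w i = x] =
  p%:R^-1 * \sum_(t : 'F_p) cosp R (t * x) * \prod_(i : I) cosp R (t * w i).
  rewrite PrE.
  transitivity ((2^-1) ^+ #|I| * (p%:R^-1 * \sum_(t : 'F_p)
      \sum_(xi : {ffun I -> bool}) 1 * cosp R (- (t * x) +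
        \sum_(i in [set: I]%SET) (-1) ^+ xi i * (t * w i)))).
    congr (_ * _); rewrite exchange_big mulr_sumr; apply: eq_bigr => xi _.
    have -> : (xi \in [set xi0 : {ffun I -> bool} |
       \sum_(i : I) (rademacher (xi0 i))%:~R * w i = x]) =
       (- x + \sum_(i : I) (-1) ^+ xi i * w i == 0).
      under [in RHS]eq_bigr do rewrite -rademacher_Fp.
      rewrite addrC subr_eq0.
      by apply/idP/eqP => [/set_mem//|h]; apply/mem_set.
    rewrite (indicator_cosp R p_pr); congr (_ * _); apply: eq_bigr => t _.
    rewrite mul1r; congr cosp; rewrite mulrDr mulrN; congr (_ + _).
    rewrite mulr_sumr; apply: eq_big => i; first by rewrite inE.
    by move=> _; rewrite mulrCA.
  rewrite mulrCA; congr (_ * _); rewrite mulr_sumr; apply: eq_bigr => t _.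
  rewrite (sum_flip_cosp (c := id) (F := fun=> 1) (z := fun=> - (t * x)))//.
  rewrite /= -mulr_suml !mulrA sum_coins mul1r cospN//; congr (_ * _).
  by apply: eq_bigl => i; rewrite inE.
rewrite (bigD1 0)//= mulrDr mul0r cosp0 mul1r big1 => [|i _]; last first.
  by rewrite mul0r cosp0.
rewrite mulr1 addrAC subrr add0r normrM ger0_norm ?invr_ge0//.
rewrite ler_wpM2l ?invr_ge0//; apply: le_trans (ler_norm_sum _ _ _) _.
apply: ler_sum => t _; rewrite normrM normr_prod ler_piMl ?cosp_le1//.
by apply: prodr_ge0.
Qed.

Lemma disc_le1 (I : finType) (w : I -> 'F_p) : disc R w <= 1.
Proof.
apply: ge_sup; first by exists (`| Pr R [set xi : {ffun I -> bool} |
  \sum_(i : I) (rademacher (xi i))%:~R * w i = 0] - p%:R^-1 |); exists 0.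
move=> _ [x _ <-].
have p0 : 0 <= (p%:R^-1 : R) <= 1.
  by rewrite invr_ge0 ler0n/= invf_le1 ?ltr0n ?ler1n prime_gt0.
set E := [set xi | _ = x].
have : 0 <= Pr R E <= 1.
  rewrite PrE mulr_ge0 ?exprn_ge0 ?sumr_ge0//=.
  rewrite -[leRHS](sum_coins I) ler_wpM2l ?exprn_ge0//.
  by apply: ler_sum => xi _; rewrite lern1 leq_b1.
by rewrite ler_norml; lra.
Qed.

End RademacherSums.

(** * Size and growth of Bohr balls *)

Section Balls.
Variables (R : realType) (p : nat).
Hypotheses (p_pr : prime p) (p_gt2 : (2 < p)%N).
Variable w : 'F_p -> R.
Hypothesis w_ge0 : forall t, 0 <= w t.
Implicit Types (x y t u v : 'F_p) (b c : R).

Definition mass : R := \sum_t w t.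
Definition bohr_norm x : R := \sum_t w t * `|sinp R (t * x)|.
Definition bohr_ball b : {set 'F_p} := [set x | bohr_norm x <= b * mass]%SET.

Lemma mass_ge0 : 0 <= mass. Proof. exact: sumr_ge0. Qed.

Lemma bohr_ball0 b : 0 <= b -> 0 \in bohr_ball b.
Proof.
move=> b0; rewrite inE /bohr_norm big1 ?mulr_ge0 ?mass_ge0// => t _.
by rewrite mulr0 sinp0 normr0 mulr0.
Qed.

Lemma bohr_ballD b c x y : x \in bohr_ball b -> y \in bohr_ball c -> x + y \in bohr_ball (b + c).
Proof.
rewrite !inE mulrDl => xb yc; apply: le_trans (lerD xb yc).
rewrite -big_split/=; apply: ler_sum => t _.
by rewrite -mulrDr ler_wpM2l// mulrDr normr_sinpD.
Qed.

Lemma bohr_ballN b x : (- x \in bohr_ball b) = (x \in bohr_ball b).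
Proof.
rewrite !inE; congr (_ <= _); apply: eq_bigr => t _.
by rewrite mulrN sinpN// normrN.
Qed.

Lemma bohr_ball_mono b c : b <= c -> bohr_ball b \subset bohr_ball c.
Proof.
move=> bc; apply/fintype.subsetP => x; rewrite !inE => /le_trans; apply.
by rewrite ler_wpM2r// mass_ge0.
Qed.

Lemma natr_Fp x : (nat_of_ord x)%:R = x.
Proof. by apply: val_inj; rewrite /= val_Fp_nat// modn_small// -[X in (_ < X)%N]Fp_cast. Qed.

(* Going up the multiples of x0, the first one to leave the ball of radius
   c + b is a point y such that y + bohr_ball b avoids bohr_ball c. *)
Lemma bohr_ball_translate b c x0 : 0 <= b -> 0 <= c -> x0 \in bohr_ball b -> x0 != 0 ->
  bohr_ball (c + 3 * b) != [set: 'F_p]%SET ->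
  (#|bohr_ball c| + #|bohr_ball b| <= #|bohr_ball (c + 3 * b)|)%N.
Proof.
move=> b0 c0 x0b x0n0 bT.
have [i Hi] : exists i : nat, x0 *+ i \notin bohr_ball (c + b).
  apply: contrapT => /forallNP h; move/negP: bT; apply.
  rewrite -finset.subTset; apply/fintype.subsetP => y _.
  have := h (val (y / x0)); move/negP; rewrite negbK -(mulr_natr x0) natr_Fp.
  rewrite mulrC divfK// => yb; apply: (fintype.subsetP (bohr_ball_mono _)) yb.
  by lra.
have : exists i : nat, x0 *+ i \notin bohr_ball (c + b) by exists i.
move/ex_minnP => [[|k] yk kmin].
  by move: yk; rewrite mulr0n bohr_ball0// addr_ge0.
have y1 : x0 *+ k \in bohr_ball (c + b).
  by apply: contraT => /kmin; rewrite ltnn.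
have y2 : x0 *+ k.+1 \in bohr_ball (c + 2 * b).
  rewrite (_ : c + 2 * b = b + (c + b)); last by ring.
  by rewrite mulrS; apply: bohr_ballD.
set y := x0 *+ k.+1 in yk y2.
rewrite -(card_imset (mem (bohr_ball b)) (addrI y)) -cardsUI.
rewrite (_ : _ :&: _ = finset.set0)%SET ?cards0 ?addn0.
  apply: subset_leq_card; rewrite finset.subUset bohr_ball_mono//=; last by lra.
  apply/fintype.subsetP => _ /imsetP[x xb ->].
  rewrite (_ : c + 3 * b = (c + 2 * b) + b); last by ring.
  exact: bohr_ballD.
apply/finset.setP => u; rewrite !inE; apply/negbTE/negP => /andP[uc /imsetP[x xb ux]].
move/negP: yk; apply; rewrite (_ : y = u + - x) ?bohr_ballD ?bohr_ballN//; last first.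
  by rewrite ux addrK.
by rewrite inE.
Qed.

(** Iterates [bohr_ball_translate]: each increase of the radius by 3 * b adds at least
    [#|bohr_ball b|] elements while the ball is proper. *)
Lemma bohr_ball_growth b x0 (j : nat) : 0 <= b -> x0 \in bohr_ball b -> x0 != 0 ->
  bohr_ball ((3 * j + 1)%:R * b) != [set: 'F_p]%SET ->
  (j.+1 * #|bohr_ball b| <= #|bohr_ball ((3 * j + 1)%:R * b)|)%N.
Proof.
move=> b0 x0b x0n0; elim: j => [|j IH] bT; first by rewrite mul1r mul1n.
have e : (3 * j.+1 + 1)%:R * b = (3 * j + 1)%:R * b + 3 * b :> R.
  by rewrite -mulrDl; congr (_ * _); rewrite mulnS; ring.
rewrite mulSnr e (leq_trans _ (bohr_ball_translate b0 _ x0b x0n0 _)) -?e//.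
- rewrite leq_add2r IH//; apply: contra_neq bT => h; apply/eqP.
  by rewrite -finset.subTset -h e bohr_ball_mono// lerDl mulr_ge0.
- by rewrite mulr_ge0.
Qed.

Lemma Fp_two_neq0 : 2 != 0 :> 'F_p.
Proof.
by apply/eqP => h; have := val_Fp_nat p_pr 2; rewrite h modn_small.
Qed.

Lemma Fp_double_eq0 t : (t + t == 0) = (t == 0).
Proof. by rewrite -mulr2n -(mulr_natr t 2) mulf_eq0 (negbTE Fp_two_neq0) orbF. Qed.

(** Orthogonality of cosines; - u occurs because u and - u have the same cosine. Arguments are
    doubled in view of cos 2a = 1 - 2 sin^2 a, and p odd makes doubling injective. *)
Lemma sum_cosp2 t u : \sum_x cosp R (t * x + t * x) * cosp R (u * x + u * x) =
  p%:R / 2 * ((t == u)%:R + (t == - u)%:R).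
Proof.
have h (v : 'F_p) : \sum_x cosp R (v * x + v * x) = p%:R * (v == 0)%:R.
  under eq_bigr do rewrite -mulrDl mulrC.
  rewrite sum_cosp// Fp_double_eq0.
  by case: eqP; rewrite ?mulr1 ?mulr0.
rewrite -[t == u]subr_eq0 -[t == - u]subr_eq0 opprK.
rewrite mulrDr -!mulrA ![2^-1 * _]mulrC !mulrA -!h -mulrDl -big_split/=.
rewrite mulr_suml; apply: eq_bigr => x _.
have := cospDB R p_pr (t * x + t * x) (u * x + u * x).
have -> : t * x + t * x - (u * x + u * x) = (t - u) * x + (t - u) * x by ring.
have -> : t * x + t * x + (u * x + u * x) = (t + u) * x + (t + u) * x by ring.
by move=> h'; lra.
Qed.

(** Since cos 2a >= 1 - 2 |sin a|, the sum is at least mass - 2 (mass / 4). *)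
Lemma mass_bohr_ball_cosp x : x \in bohr_ball 4^-1 ->
  mass / 2 <= \sum_t w t * cosp R (t * x + t * x).
Proof.
rewrite inE => xb.
have : \sum_t w t * (1 - 2 * `|sinp R (t * x)|) <=
       \sum_t w t * cosp R (t * x + t * x).
  apply: ler_sum => t _; rewrite ler_wpM2l// cospDx//.
  have := sin_max (angle R (t * x)); rewrite -/(sinp R (t * x)) => s1.
  rewrite lerD2l lerN2 ler_wpM2l// -real_normK ?num_real//.
  by rewrite expr2 ler_piMl.
apply: le_trans.
under eq_bigr do rewrite mulrBr mulr1 mulrCA.
by rewrite sumrB -mulr_sumr -/mass -/(bohr_norm x); lra.
Qed.

(** Without the frequency 0 the cosine transform of w sums to 0 over x, so it cannot be at least
    mass / 2 everywhere. *)
Lemma bohr_ball_proper : w 0 = 0 -> 0 < mass -> bohr_ball 4^-1 != [set: 'F_p]%SET.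
Proof.
move=> w0 W0; apply/eqP => bT.
have : \sum_(x : 'F_p) mass / 2 <= \sum_x \sum_t w t * cosp R (t * x + t * x).
  by apply: ler_sum => x _; apply: mass_bohr_ball_cosp; rewrite bT inE.
rewrite [leRHS]exchange_big [leRHS]big1 => [|t _].
  by rewrite sumr_const card_Fp// leNgt pmulrn_lgt0 ?prime_gt0// divr_gt0.
have [->|t0] := eqVneq t 0; first by rewrite w0; under eq_bigr do rewrite mul0r; rewrite big1.
rewrite -mulr_sumr; under eq_bigr do rewrite -mulrDl mulrC.
by rewrite sum_cosp// Fp_double_eq0 (negbTE t0) mulr0.
Qed.

(** Parseval: the cosine transform f of w is at least mass / 2 on the ball, whereas the sum of f^2
    is at most p * mass because w <= 1. *)
Lemma bohr_ball_card : (forall t, w t <= 1) -> 0 < mass ->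
  #|bohr_ball 4^-1|%:R * mass <= 4 * p%:R.
Proof.
move=> w1 W0.
pose f x := \sum_t w t * cosp R (t * x + t * x).
have lo : #|bohr_ball 4^-1|%:R * (mass / 2) ^+ 2 <= \sum_x f x ^+ 2.
  rewrite mulr_natl -sumr_const [leRHS](bigID (mem (bohr_ball 4^-1)))/=.
  rewrite ler_wpDr ?sumr_ge0// => [x _|]; first exact: sqr_ge0.
  apply: ler_sum => x xb; have m0 : 0 <= mass / 2 by rewrite divr_ge0 ?mass_ge0.
  by rewrite !expr2 ler_pM// mass_bohr_ball_cosp.
have hi : \sum_x f x ^+ 2 <= p%:R * mass.
  have -> : \sum_x f x ^+ 2 = \sum_t \sum_u w t * w u *
      (p%:R / 2 * ((t == u)%:R + (t == - u)%:R)).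
    transitivity (\sum_x \sum_t \sum_u w t * w u *
      (cosp R (t * x + t * x) * cosp R (u * x + u * x))).
      apply: eq_bigr => x _; rewrite expr2 /f mulr_suml; apply: eq_bigr => t _.
      by rewrite mulr_sumr; apply: eq_bigr => u _; ring.
    rewrite exchange_big; apply: eq_bigr => t _; rewrite exchange_big/=.
    by apply: eq_bigr => u _; rewrite -mulr_sumr sum_cosp2.
  rewrite /mass mulr_sumr; apply: ler_sum => t _.
  have -> : \sum_u w t * w u * (p%:R / 2 * ((t == u)%:R + (t == - u)%:R)) =
     w t * (p%:R / 2) * (w t + w (- t)).
    transitivity (\sum_u (w t * (p%:R / 2) * (if u == t then w u else 0) +
                          w t * (p%:R / 2) * (if u == - t then w u else 0))).
      apply: eq_bigr => u _.
      rewrite (eq_sym t u) (_ : (t == - u) = (u == - t)); last first.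
        by rewrite -[LHS]eqr_oppLR eq_sym.
      by case: (u == t); case: (u == - t) => /=; ring.
    by rewrite big_split/= -!mulr_sumr -!big_mkcond !big_pred1_eq; ring.
  rewrite -mulrA [leRHS]mulrC ler_wpM2l//.
  have := w1 t; have := w1 (- t); have : 0 <= p%:R :> R by [].
  have := w_ge0 t; have := w_ge0 (- t).
  nra.
have := le_trans lo hi.
rewrite expr2 mulrA.
have -> : #|bohr_ball 4^-1|%:R * (mass / 2) * (mass / 2) =
  (#|bohr_ball 4^-1|%:R * mass / 4) * mass by field.
by rewrite ler_pM2r//; lra.
Qed.

(** With s = |sin| and c = |cos|, the bounds 2 tau s <= tau^2 + s^2 and s^2 = 1 - c^2 <= 2 (1 - c)
    give s <= (1 - c) / tau + tau / 2. In the weighted sum, the hypothesis bounds the first part by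
    tau * mass. *)
Lemma bohr_ball_of_weight tau x : 0 < tau ->
  (1 - tau ^+ 2) * mass < \sum_t w t * `|cosp R (t * x)| -> x \in bohr_ball (2 * tau).
Proof.
move=> tau0 h; rewrite inE.
have : \sum_t w t * `|sinp R (t * x)| <=
    \sum_t w t * (tau^-1 * (1 - `|cosp R (t * x)|) + tau / 2).
  apply: ler_sum => t _; rewrite ler_wpM2l//.
  have := cosp2Dsinp2 R (t * x); 
  rewrite -(real_normK (num_real (cosp R _))) -(real_normK (num_real (sinp R _))).
  have := cosp_le1 R (t * x).
  move: `|cosp R (t * x)| (normr_ge0 (cosp R (t * x))) => c c0 c1.
  move: `|sinp R (t * x)| (normr_ge0 (sinp R (t * x))) => s s0 cs.
  rewrite -(ler_pM2l tau0) mulrDr mulVKf ?gt_eqF//.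
  have h1 : 0 <= (tau - s) ^+ 2 by exact: sqr_ge0.
  have h2 : 0 <= (1 - c) * (1 - c) by rewrite mulr_ge0// subr_ge0.
  by lra.
rewrite -/(bohr_norm x) => /le_trans; apply.
under eq_bigr do rewrite mulrDr mulrCA mulrBr mulr1.
rewrite big_split/= -mulr_sumr -mulr_suml sumrB -/mass.
set c := \sum_t w t * `|cosp R (t * x)| in h *.
have h2 : tau^-1 * (mass - c) <= tau * mass.
  rewrite -(ler_pM2l tau0) mulVKf ?gt_eqF// mulrA -expr2; lra.
have h3 : 0 <= tau * mass by rewrite mulr_ge0 ?mass_ge0 ?ltW.
by lra.
Qed.

End Balls.

(** * Greedy choice, packing and counting *)

Section Combinatorics.
Variable R : realType.

(** If no set of fewer than m elements were blocked, m greedy steps would each multiply the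
    potential G by at most q and reach an m-subset contradicting the hypothesis. *)
Lemma greedy_set (I : finType) (U : {set I}) (G : {set I} -> R) (q : R) (m : nat) :
  0 <= q ->
  (forall S : {set I}, S \subset U -> #|S| = m -> q ^+ m * G finset.set0 < G S) ->
  exists S : {set I}, [/\ S \subset U, (#|S| < m)%N &
    forall i, i \in U -> i \notin S -> q * G S < G (i |: S)%SET].
Proof.
move=> q0 Gm; apply: contrapT => nS.
suff [S [SU Sm GS]] : exists S : {set I},
    [/\ S \subset U, #|S| = m & G S <= q ^+ m * G finset.set0].
  by have := Gm _ SU Sm; rewrite ltNge GS.
have : (m <= m)%N by [].
elim: {1 3 4}m => [_|k IH km].
  by exists finset.set0; rewrite finset.sub0set cards0 expr0 mul1r.
have [S [SU Sk GS]] := IH (ltnW km).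
have [i [iU iS Gi]] : exists i, [/\ i \in U, i \notin S & G (i |: S)%SET <= q * G S].
  apply: contrapT => /forallNP h; apply: nS; exists S; split=> //.
    by rewrite Sk.
  by move=> i iU iS; rewrite ltNge; apply/negP => Gi; apply: (h i).
exists (i |: S)%SET; split.
- by rewrite finset.subUset finset.sub1set iU.
- by rewrite cardsU1 iS Sk.
- by apply: le_trans Gi _; rewrite exprS -mulrA ler_wpM2l.
Qed.

(** Take a largest disjoint family of good sets. If it has fewer than n/(2m) members it covers less
    than n/2 points, so U, what remains outside T, has at least n/4 points and contains no further
    good set. *)
Lemma packing (n m : nat) (good : pred {set 'I_n}) (T : {set 'I_n}) :
  (0 < m)%N -> #|T| = (n %/ 4)%N ->
  (exists F : {set {set 'I_n}}, [/\ finset.trivIset F, (n <= #|F| * (2 * m))%N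
     & forall S, S \in F -> [/\ S \subset ~: T, #|S| = m & good S]]) \/
  (exists U : {set 'I_n}, (n <= 4 * #|U|)%N /\
     forall S : {set 'I_n}, S \subset U -> #|S| = m -> ~~ good S).
Proof.
move=> m0 cT.
pose P (F : {set {set 'I_n}}) := finset.trivIset F &&
  [forall S in F, [&& S \subset ~: T, #|S| == m & good S]].
have P0 : P finset.set0.
  apply/andP; split; last by apply/forall_inP => S; rewrite inE.
  by apply/finset.trivIsetP => A B; rewrite inE.
have [F /andP[Ft /forall_inP Fg] Fmax] := arg_maxnP (fun F : {set {set 'I_n}} => #|F|) P0.
have [nF|Fn] := leqP n (#|F| * (2 * m)).
  left; exists F; split=> // S /Fg /and3P[? /eqP ? ?]; by split.
right; exists (~: T :\: finset.cover F)%SET; split.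
  have cF : (#|finset.cover F| <= #|F| * m)%N.
    apply: leq_trans (finset.leq_card_cover F) _; rewrite -sum_nat_const.
    by apply: leq_sum => S /Fg /and3P[_ /eqP -> _].
  have := cardsC T; rewrite cT card_ord.
  have := cardsID (finset.cover F) (~: T)%SET.
  have := subset_leq_card (finset.subsetIr (~: T)%SET (finset.cover F)).
  by move: #|finset.cover F| cF Fn => c; nia.
move=> S SU Sm; apply/negP => gS.
have dis : forall B : {set 'I_n}, B \in F -> fintype.disjoint (mem S) (mem B).
  move=> B BF; rewrite fintype.disjoint_subset; apply/fintype.subsetP => i iS.
  have := fintype.subsetP SU i iS; rewrite !inE => /andP[iF _].
  by apply: contra iF => iB; apply/bigcupP; exists B.
(* As [trivIset] allows the empty set, its exclusion is needed to know that S is new to F. *)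
have F0 : finset.set0 \notin F.
  by apply/negP => /Fg /and3P[_]; rewrite cards0 => /eqP e; rewrite -e in m0.
have [SFt SF] := finset.trivIsetU1 dis Ft F0.
have : P (S |: F)%SET.
  rewrite /P SFt; apply/forall_inP => A /setU1P[->|]; last exact: Fg.
  rewrite Sm eqxx gS/= andbT; apply: fintype.subset_trans SU _.
  exact: finset.subsetDl.
by move/Fmax; rewrite /= cardsU1 SF add1n ltnn.
Qed.

(** The box X v depends only on the coordinates outside U. Once these are fixed, at most |X|^|U|
    vectors remain, of total weight at most 1; the right-hand side counts the choices outside U. *)
Lemma sum_box (I T : finType) (t0 : T) (Q : pred {ffun I -> T}) (U : {set I})
    (X : {ffun I -> T} -> {set T}) :
  (forall u v : {ffun I -> T}, (forall i, i \notin U -> u i = v i) -> X u = X v) ->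
  (forall v, Q v -> forall i, i \in U -> v i \in X v) ->
  \sum_(v | Q v) (#|X v|%:R^-1 : R) ^+ #|U| <= #|T|%:R ^+ #|~: U|.
Proof.
move=> Xdep QX.
pose rho (v : {ffun I -> T}) := [ffun i => if i \in U then t0 else v i].
have rhoX v : X (rho v) = X v.
  by apply: Xdep => i iU; rewrite ffunE (negbTE iU).
rewrite (partition_big rho (mem (pffun_on t0 (mem (~: U)%SET) predT)))/=; last first.
  move=> v _; apply/pffun_onP; split; last by [].
  apply/fintype.subsetP => i; rewrite !inE ffunE; by case: (i \in U); rewrite ?eqxx.
have -> : #|T|%:R ^+ #|~: U| =
    \sum_(u in pffun_on t0 (mem (~: U)%SET) (mem (predT : pred T))) (1 : R).
  by rewrite sumr_const card_pffun_on natrX.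
apply: ler_sum => u uD.
pose A i : pred T := fun t => if i \in U then t \in X u else t == u i.
apply: (@le_trans _ _ (\sum_(v in family A) (#|X u|%:R^-1 : R) ^+ #|U|)).
  rewrite big_mkcond [leRHS]big_mkcond; apply: ler_sum => v _.
  case: ifP => [/andP[Qv /eqP vu]|_]; last by case: ifP => // _; rewrite exprn_ge0.
  rewrite ifT -?(rhoX v) ?vu//; apply/familyP => i; rewrite /A unfold_in -vu rhoX.
  by case: ifP => iU; [exact: QX|rewrite ffunE iU].
rewrite sumr_const card_family.
have -> : foldr muln 1%N [seq #|A x| | x : I] = (#|X u| ^ #|U|)%N.
  rewrite foldrE big_map big_enum/= (bigID (mem U))/= [X in (_ * X)%N]big1 ?muln1.
    rewrite -prod_nat_const; apply: eq_bigr => i iU.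
    by apply: eq_card => t; rewrite unfold_in /A iU.
  move=> i iU; rewrite -(card1 (u i)); apply: eq_card => t.
  by rewrite unfold_in /A (negbTE iU).
rewrite -[leLHS]mulr_natr natrX -exprMn.
(* For an empty box the inverse is 0 by convention, and a power of 0 is at most 1. *)
have [->|x0] := eqVneq (#|X u|%:R : R) 0; last by rewrite mulVf// expr1n.
by rewrite mulr0 expr0n; case: (_ == _).
Qed.

(** Each small O has K^(q - |O|) >= 1, and the sum of K^(- |O|) over all O is (1 + 1/K)^|I|. *)
Lemma card_small_sets (I : finType) (K : R) (q : nat) : 1 <= K ->
  #|[set O : {set I} | (#|O| <= q)%N]%SET|%:R <= K ^+ q * (1 + K^-1) ^+ #|I|.
Proof.
move=> K1; have K0 : 0 < K by lra.
have -> : (1 + K^-1) ^+ #|I| = \sum_(O : {set I}) K^-1 ^+ #|O|.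
  rewrite -prodr_const addrC bigA_distr; apply: eq_bigr => O _.
  rewrite -[RHS]prodr_const [RHS]big_mkcond/=.
  by apply: eq_bigr => i _; case: ifP.
rewrite mulr_sumr -sum1_card natr_sum big_mkcond/=.
apply: ler_sum => O _; case: ifP; last by rewrite mulr_ge0 ?exprn_ge0 ?invr_ge0 ?ltW.
rewrite inE => Oq; rewrite exprVn -(subnK Oq) exprD mulfK ?expf_neq0 ?gt_eqF//.
by rewrite exprn_ege1.
Qed.

End Combinatorics.

(** * Orthogonality to rows of the random symmetric matrix *)

Section SymmetricMatrix.
Variables (R : realType) (p : nat).
Hypothesis p_pr : prime p.
Variables (n : nat) (lambda : 'F_p).
Implicit Types (v : 'I_n -> 'F_p) (i j : 'I_n) (S J O : {set 'I_n}).

(** The modulus of the characteristic function of the signed sum of v over S; its mean [conc] bounds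
    every point probability of that sum. *)
Definition weight v S (t : 'F_p) : R := \prod_(i in S) `|cosp R (t * v i)|.
Definition conc v S : R := p%:R^-1 * \sum_(t : 'F_p) weight v S t.

Definition shifted_mx (xi : {ffun upper n -> bool}) : 'M['F_p]_n :=
  map_mx (intr : int -> 'F_p) (sym_rademacher_mx xi) - lambda%:M.

Lemma sort_pair_eq i j k l : sort_pair i j = sort_pair k l ->
  (i = k /\ j = l) \/ (i = l /\ j = k).
Proof.
move/(congr1 val) => /=.
by case: ifP => _; case: ifP => _ [-> ->]; [left|right|right|left].
Qed.

Lemma orth_rowsE xi (v : 'cV['F_p]_n) i : (i \in orth_rows (shifted_mx xi) v) =
  (\sum_j ((-1) ^+ xi (sort_pair i j) - lambda *+ (i == j)) * v j 0 == 0).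
Proof.
rewrite inE; apply/eqP/eqP => [/matrixP/(_ 0 0)|h].
  rewrite !mxE => h; rewrite -[RHS]h; apply: eq_bigr => j _.
  by rewrite !mxE rademacher_Fp.
apply/matrixP => x y; rewrite !ord1 !mxE -[RHS]h; apply: eq_bigr => j _.
by rewrite !mxE rademacher_Fp.
Qed.

(* Exposing the rows of O one at a time: the entries (i, j) with j in J and
   i outside J occur in no other row of O :\: J. *)
Lemma Pr_orth_le (v : 'cV['F_p]_n) O J :
  Pr R [set xi | O \subset orth_rows (shifted_mx xi) v] <=
  conc (fun i => v i 0) J ^+ #|O :\: J|.
Proof.
rewrite PrE -[leRHS]mul1r -[X in _ <= X * _](sum_coins R (upper n)) -mulrA.
rewrite ler_wpM2l ?exprn_ge0//.
have c0 : 0 <= conc (fun i => v i 0) J.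
  by rewrite mulr_ge0 ?invr_ge0// sumr_ge0// => t _; apply: prodr_ge0.
pose F (B : {set 'I_n}) (xi : {ffun upper n -> bool}) : R :=
  (B \subset orth_rows (shifted_mx xi) v)%:R.
suff FB (B : {set 'I_n}) : B \subset (~: J)%SET ->
    \sum_xi F B xi <= (\sum_(xi : {ffun upper n -> bool}) 1) *
                      conc (fun i => v i 0) J ^+ #|B|.
  apply: le_trans (FB (O :\: J)%SET _); last first.
    by apply/fintype.subsetP => i; rewrite !inE => /andP[].
  apply: ler_sum => xi _; rewrite ler_nat /F.
  case: (boolP (_ \in _)) => //= /set_mem /= OS.
  by rewrite (fintype.subset_trans (finset.subsetDl O J) OS).
elim: {B}_.+1 {-2}B (ltnSn #|B|) => // k IH B Bk BJ.
have [->|[i iB]] := set_0Vmem B.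
  rewrite cards0 expr0 mulr1; apply: ler_sum => xi _.
  by rewrite /F lern1 leq_b1.
pose B' := (B :\ i)%SET.
have cB : #|B| = #|B'|.+1 by rewrite (cardsD1 i) iB.
have B'J : B' \subset (~: J)%SET.
  by apply: fintype.subset_trans BJ; exact: finset.subsetDl.
have iJ : i \notin J by have := fintype.subsetP BJ i iB; rewrite inE.
pose z (xi : {ffun upper n -> bool}) :=
  \sum_(j in ~: J) ((-1) ^+ xi (sort_pair i j) - lambda *+ (i == j)) * v j 0.
have -> : \sum_xi F B xi = \sum_xi F B' xi *
    (z xi + \sum_(j in J) (-1) ^+ xi (sort_pair i j) * v j 0 == 0)%:R.
  apply: eq_bigr => xi _; rewrite /F -[in LHS](finset.setD1K iB).
  rewrite finset.subUset finset.sub1set andbC -mulnb natrM; congr (_ * _%:R).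
  rewrite orth_rowsE (bigID (mem J))/= addrC; congr (nat_of_bool (_ + _ == 0)).
    by apply: eq_bigl => j; rewrite inE.
  apply: eq_bigr => j jJ; rewrite (_ : (i == j) = false) ?mulr0n ?subr0//.
  by apply: contraNF iJ => /eqP ->.
rewrite cB exprSr mulrA; apply: le_trans (ler_wpM2r c0 (IH B' _ B'J)); last first.
  by rewrite -ltnS -cB.
apply: sum_flip_eq0_le.
- exact: p_pr.
- by move=> j l _ _ /sort_pair_eq[[_ //]|[<- <-]].
- move=> j xi jJ; rewrite /F; apply: (congr1 (fun b : bool => b%:R)).
  have e l : l \in B' -> (l \in orth_rows (shifted_mx (flip (sort_pair i j) xi)) v)
      = (l \in orth_rows (shifted_mx xi) v).
    move=> lB; rewrite !orth_rowsE; apply: (congr1 (fun s => s == 0)).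
    apply: eq_bigr => h _.
    rewrite flip_neq//; apply/eqP => /sort_pair_eq[[li _]|[lj _]].
      by move: lB; rewrite li !inE eqxx.
    by have := fintype.subsetP B'J l lB; rewrite inE lj jJ.
  apply/fintype.subsetP/fintype.subsetP => h l lB.
    by rewrite -(e l lB); apply: h.
  by rewrite (e l lB); apply: h.
- move=> j xi jJ; rewrite /z; apply: eq_bigr => l; rewrite inE => lJ.
  rewrite flip_neq//; apply/eqP => /sort_pair_eq[[_ lj]|[ij _]].
    by rewrite lj jJ in lJ.
  by rewrite ij jJ in iJ.
- by move=> xi; apply: ler0n.
Qed.

Lemma weight_le1 v S t : weight v S t <= 1.
Proof. by apply: prodr_ile1 => i _; rewrite normr_ge0 cosp_le1. Qed.

Lemma weight_ge0 v S t : 0 <= weight v S t.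
Proof. exact: prodr_ge0. Qed.

Lemma weightU1 v S i t : i \notin S ->
  weight v (i |: S)%SET t = weight v S t * `|cosp R (t * v i)|.
Proof. by move=> iS; rewrite /weight big_setU1// [LHS]mulrC. Qed.

Lemma weight0 v S : weight v S 0 = 1.
Proof. by rewrite /weight big1// => i _; rewrite mul0r cosp0 normr1. Qed.

Lemma weight_set0 v t : weight v finset.set0 t = 1.
Proof. by rewrite /weight big_set0. Qed.

Lemma mass_weight_ge1 v S : 1 <= mass (weight v S).
Proof.
rewrite /mass (bigD1 0)//= weight0 lerDl sumr_ge0// => t _; exact: weight_ge0.
Qed.

Lemma concE v S : conc v S = p%:R^-1 * mass (weight v S). Proof. by []. Qed.

Lemma conc_ge v S : p%:R^-1 <= conc v S.
Proof. by rewrite concE -[leLHS]mulr1 ler_wpM2l ?invr_ge0// mass_weight_ge1. Qed.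

Lemma conc_le1 v S : conc v S <= 1.
Proof.
rewrite concE mulrC ler_pdivrMr ?ltr0n ?prime_gt0// mul1r.
rewrite -[in leRHS](card_Fp p_pr) -sumr_const /mass.
by apply: ler_sum => t _; exact: weight_le1.
Qed.

(** From 2 |cos a| <= 1 + cos^2 a one gets |cos a| <= 3/4 + (cos 2a) / 4, and the last term sums to
    0 because 2 v_j <> 0. *)
Lemma conc1_le v j : (2 < p)%N -> v j != 0 -> conc v [set j]%SET <= 3 / 4.
Proof.
move=> p2 vj; rewrite concE mulrC ler_pdivrMr ?ltr0n ?prime_gt0//.
have : mass (weight v [set j]%SET) <=
    \sum_t (3 / 4 + 4^-1 * cosp R (t * (v j + v j))).
  apply: ler_sum => t _; rewrite /weight big_set1 mulrDr cospDx//.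
  have := cosp2Dsinp2 R (t * v j).
  rewrite -(real_normK (num_real (cosp R _))).
  have := sqr_ge0 (1 - `|cosp R (t * v j)|); rewrite sqrrB expr1n.
  by lra.
move/le_trans; apply; rewrite big_split/= -[X in _ + X]mulr_sumr sum_cosp//.
by rewrite Fp_double_eq0// (negbTE vj) mulr0 addr0 sumr_const card_Fp// mulr_natr.
Qed.

Lemma disc_restr_le (v : 'cV['F_p]_n) S : disc R (restr v S) <=
  p%:R^-1 * \sum_(t : 'F_p | t != 0) weight (fun i => v i 0) S t.
Proof.
apply: le_trans (disc_le R p_pr _) _.
rewrite le_eqVlt; apply/orP; left; apply/eqP; congr (_ * _).
apply: eq_bigr => t _; rewrite /weight [RHS]big_sub.
exact: eq_bigr.
Qed.

End SymmetricMatrix.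

(** * The radius constant tau *)

Section Radius.
Variables (R : realType) (j : nat).

(* The constant tau: a ball of radius (3 * j + 1) * (2 * tau) is contained in the
   ball of radius 1/4. *)
Definition bohr_radius : R := (32 * j.+1%:R)^-1.

Lemma bohr_radius_gt0 : 0 < bohr_radius.
Proof. by rewrite invr_gt0 mulr_gt0// ltr0n. Qed.

Lemma bohr_radius_lt1 : bohr_radius < 1.
Proof. by rewrite /bohr_radius -natrM invf_lt1 ?ltr0n// ltr1n; lia. Qed.

Lemma subr_sqr_bohr_radius_ge0 : 0 <= 1 - bohr_radius ^+ 2.
Proof.
by rewrite subr_ge0 expr_le1 ?ltW ?bohr_radius_lt1 ?bohr_radius_gt0.
Qed.

End Radius.

(** * Structure of the vectors with concentrated or biased sums *)

Section Structure.
Variables (R : realType) (p : nat).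
Hypotheses (p_pr : prime p) (p_gt2 : (2 < p)%N).
Variables (n m j : nat).
Implicit Types (v : 'I_n -> 'F_p) (i : 'I_n) (S U J : {set 'I_n}).

Hypothesis hm : (1 - bohr_radius R j ^+ 2) ^+ m * p%:R ^+ 2 <= 1.

(** Removing the frequency 0 gives the weight that controls the discrepancy, and makes its ball of
    radius 1/4 proper when the mass is positive. *)
Definition weight0r v S (t : 'F_p) : R := (t != 0)%:R * weight R v S t.

Lemma weight0r_ge0 v S t : 0 <= weight0r v S t.
Proof. by rewrite mulr_ge0// weight_ge0. Qed.

Lemma eq_weight v v' S : {in S, v =1 v'} -> weight R v S = weight R v' S.
Proof.
by move=> vv; apply/funext => t; apply: eq_bigr => i iS; rewrite vv.
Qed.

(** A nonzero element lets the ball grow by the factor j + 1 up to radius (3 j + 1) * 2 tau <=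
    1/4. *)
Lemma small_ball (w : 'F_p -> R) : (forall t, 0 <= w t) ->
  bohr_ball w 4^-1 != [set: 'F_p]%SET ->
  bohr_ball w (2 * bohr_radius R j) \subset [set 0]%SET \/
  (j.+1 * #|bohr_ball w (2 * bohr_radius R j)| <= #|bohr_ball w 4^-1|)%N.
Proof.
move=> w0 bT.
have [|/subsetPn[x0 x0b]] := boolP (bohr_ball w (2 * bohr_radius R j) \subset [set 0]%SET).
  by left.
rewrite inE => x00; right.
have sub : bohr_ball w ((3 * j + 1)%:R * (2 * bohr_radius R j)) \subset bohr_ball w 4^-1.
  apply: bohr_ball_mono => //; rewrite /bohr_radius natrD natrM.
  have j0 : 0 < j.+1%:R :> R by rewrite ltr0n.
  rewrite mulrA ler_pdivrMr ?mulr_gt0// -natr1; have := ler0n R j; lra.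
apply: leq_trans (subset_leq_card sub); apply: bohr_ball_growth x0b x00 _ => //.
  by rewrite mulr_ge0// ltW// bohr_radius_gt0.
by apply: contra_neq bT => h; apply/eqP; rewrite -finset.subTset -h.
Qed.

(** Greedy choice with the mass as potential: it starts at p and never drops below 1, while (1 -
    tau^2)^m * p < 1. *)
Lemma concentrated_rows v : exists J, (#|J| < m)%N /\
  forall i, i \notin J -> v i \in bohr_ball (weight R v J) (2 * bohr_radius R j).
Proof.
have [|J [_ Jm hJ]] := @greedy_set R _ [set: 'I_n]%SET
  (fun S => mass (weight R v S)) _ m (subr_sqr_bohr_radius_ge0 R j).
  move=> S _ _; apply: lt_le_trans (mass_weight_ge1 R v S).
  have -> : mass (weight R v finset.set0) = p%:R.
    rewrite /mass; under eq_bigr do rewrite weight_set0.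
    by rewrite sumr_const card_Fp.
  apply: lt_le_trans hm; rewrite (expr2 p%:R) mulrA ltr_pMr ?ltr1n ?prime_gt1//.
  rewrite mulr_gt0 ?ltr0n ?prime_gt0// exprn_gt0// subr_gt0.
  by rewrite expr_lt1 ?ltW ?bohr_radius_lt1 ?bohr_radius_gt0.
exists J; split=> // i iJ; apply: bohr_ball_of_weight => //.
- by move=> t; exact: weight_ge0.
- exact: bohr_radius_gt0.
- have := hJ i; rewrite inE => /(_ isT iJ); rewrite {2}/mass.
  by under eq_bigr do rewrite weightU1//.
Qed.

(** Greedy choice in U without the frequency 0: the potential starts at most at p and exceeds C / p
    on every m-subset, by the bias. This is why [hm] involves p^2. *)
Lemma biased_coords (v : 'cV['F_p]_n) (C : R) U : 1 <= C -> (m <= #|U|)%N ->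
  (forall S, S \subset U -> #|S| = m -> C / p%:R ^+ 2 < disc R (restr v S)) ->
  exists S, [/\ S \subset U, (#|S| < m)%N,
    0 < mass (weight0r (fun i => v i 0) S) &
    forall i, i \in U -> i \notin S ->
      v i 0 \in bohr_ball (weight0r (fun i => v i 0) S) (2 * bohr_radius R j)].
Proof.
move=> C1 mU biased; pose u i := v i 0.
have p0 : 0 < p%:R :> R by rewrite ltr0n prime_gt0.
have [|S [SU Sm hS]] := @greedy_set R _ U
  (fun S => mass (weight0r u S)) _ m (subr_sqr_bohr_radius_ge0 R j).
  move=> S SU Sm; have := biased S SU Sm.
  move/lt_le_trans => /(_ _ (disc_restr_le R p_pr v S)).
  rewrite -/u [X in _ < _ * X]big_mkcond/=.
  rewrite (eq_bigr (weight0r u S)) => [|t _]; last first.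
    by rewrite /weight0r; case: (t != 0); rewrite ?mul1r ?mul0r.
  rewrite -/(mass _) expr2 invfM mulrA mulrC ltr_pM2l ?invr_gt0//.
  apply: le_lt_trans; apply: (@le_trans _ _ (p%:R^-1)); last first.
    by rewrite ler_peMl// invr_ge0 ltW.
  apply: (@le_trans _ _ ((1 - bohr_radius R j ^+ 2) ^+ m * p%:R)).
    rewrite ler_wpM2l ?exprn_ge0 ?subr_sqr_bohr_radius_ge0// /mass.
    rewrite -[in leRHS](card_Fp p_pr) -sumr_const; apply: ler_sum => t _.
    rewrite /weight0r weight_set0 mulr1; by case: (t != 0).
  by rewrite -[leRHS]mul1r ler_pdivlMr// -mulrA -expr2.
have step i : i \in U -> i \notin S -> (1 - bohr_radius R j ^+ 2) * mass (weight0r u S) <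
    \sum_t weight0r u S t * `|cosp R (t * u i)|.
  move=> iU iS; have := hS i iU iS; rewrite {2}/mass.
  by under eq_bigr do rewrite /weight0r weightU1// mulrA.
exists S; split=> //; last first.
  move=> i iU iS; apply: bohr_ball_of_weight (step i iU iS) => //.
    by move=> t; exact: weight0r_ge0.
  exact: bohr_radius_gt0.
(* The strict inequality [step] at a point of U outside S excludes a zero mass. *)
have /subsetPn[i iU iS] : ~~ (U \subset S).
  by apply/negP => /subset_leq_card; lia.
rewrite lt_neqAle eq_sym mass_ge0 ?andbT; last by move=> t; exact: weight0r_ge0.
apply/eqP => W0; have := step i iU iS; rewrite W0 mulr0 ltNge => /negP; apply.
rewrite -[leRHS]W0; apply: ler_sum => t _.
by rewrite ler_piMr ?weight0r_ge0// cosp_le1.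
Qed.

(** By Parseval the ball of radius 1/4 has at most 4 p / mass = 4 / conc elements. A mass above 4
    makes it proper, so growth saves the factor j + 1. *)
Lemma bohr_ball_dense_card v J : 4 < mass (weight R v J) ->
  bohr_ball (weight R v J) (2 * bohr_radius R j) \subset [set 0]%SET \/
  #|bohr_ball (weight R v J) (2 * bohr_radius R j)|%:R * conc R v J <= 4 / j.+1%:R.
Proof.
move=> W4; have W0 : 0 < mass (weight R v J) by lra.
have p0 : 0 < p%:R :> R by rewrite ltr0n prime_gt0.
have w0 := weight_ge0 R v J.
have bc := bohr_ball_card p_pr p_gt2 w0 (weight_le1 R v J) W0.
have [|//|h] := small_ball w0; [|by left|right].
  apply/eqP => bT; move: bc; rewrite bT cardsT card_Fp// mulrC ler_pM2r//.
  by rewrite leNgt W4.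
rewrite ler_pdivlMr ?ltr0n// concE; set X := #|_|%:R; set W := mass _.
rewrite (_ : X * _ * _ = j.+1%:R * X * W / p%:R); last by ring.
rewrite ler_pdivrMr//; apply: le_trans bc; apply: ler_wpM2r; first exact: ltW.
by rewrite /X -natrM ler_nat.
Qed.

Lemma bohr_ball0r_card v S : 0 < mass (weight0r v S) ->
  bohr_ball (weight0r v S) (2 * bohr_radius R j) \subset [set 0]%SET \/
  #|bohr_ball (weight0r v S) (2 * bohr_radius R j)|%:R <= p%:R / j.+1%:R :> R.
Proof.
move=> W0; have w0 := weight0r_ge0 v S.
have [|//|h] := small_ball w0; [|by left|right].
  by apply: bohr_ball_proper => //; rewrite /weight0r eqxx mul0r.
rewrite ler_pdivlMr ?ltr0n// -natrM ler_nat mulnC -[leqRHS](card_Fp p_pr).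
exact: leq_trans h (max_card _).
Qed.

End Structure.

(** * Elementary union bounds *)

Section UnionBound.
Variable R : realType.

Lemma Pr_ge0 (I : finType) (E : set {ffun I -> bool}) : 0 <= Pr R E.
Proof. by rewrite PrE mulr_ge0 ?exprn_ge0// sumr_ge0. Qed.

Lemma Pr_setC (I : finType) (E : set {ffun I -> bool}) : Pr R E + Pr R (~` E) = 1.
Proof.
rewrite !PrE -mulrDr -big_split/= -[RHS](sum_coins R I); congr (_ * _).
apply: eq_bigr => xi _; rewrite in_setC.
by case: (_ \in _); rewrite ?addr0 ?add0r.
Qed.

Lemma Pr_le_sum (I A : finType) (P : pred A) (E : set {ffun I -> bool})
    (D : A -> set {ffun I -> bool}) :
  (forall xi, E xi -> exists2 a, P a & D a xi) ->
  Pr R E <= \sum_(a | P a) Pr R (D a).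
Proof.
move=> ED; under [leRHS]eq_bigr do rewrite PrE.
rewrite PrE -mulr_sumr ler_wpM2l ?exprn_ge0// exchange_big/=.
apply: ler_sum => xi _; case: (boolP (xi \in E)) => [/set_mem/ED[a Pa Da]|_]/=.
  rewrite (bigD1 a)//= (_ : xi \in D a) ?lerDl ?sumr_ge0//.
  exact/mem_set.
exact: sumr_ge0.
Qed.

Lemma ler_sum_cover (A B : finType) (P : pred A) (Q : A -> B -> bool) (g : A -> R) :
  (forall a, 0 <= g a) -> (forall a, P a -> exists b, Q a b) ->
  \sum_(a | P a) g a <= \sum_b \sum_(a | Q a b) g a.
Proof.
move=> g0 PQ; under [leRHS]eq_bigr do rewrite big_mkcond.
rewrite exchange_big big_mkcond/=; apply: ler_sum => a _; case: ifP => Pa.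
  have [b Qb] := PQ a Pa; rewrite (bigD1 b)//= Qb lerDl sumr_ge0// => c _.
  by case: ifP.
by apply: sumr_ge0 => c _; case: ifP.
Qed.

End UnionBound.

(** * Three classes of bad vectors and the total probability of each *)

Section BadVectors.
Variables (R : realType) (p : nat).
Hypotheses (p_pr : prime p) (p_gt2 : (2 < p)%N).
Variables (n m j : nat) (lambda : 'F_p) (C eps : R).
Hypothesis hm : (1 - bohr_radius R j ^+ 2) ^+ m * p%:R ^+ 2 <= 1.
Hypotheses (C1 : 1 <= C) (mn : (20 * m <= n)%N).
Hypotheses (eps0 : 0 < eps) (eps_j : 4 / j.+1%:R <= eps) (eps_p : 1 <= eps * p%:R).
Implicit Types (f g : {ffun 'I_n -> 'F_p}) (S U J O : {set 'I_n}).

Let eps_ge0 : 0 <= eps. Proof. exact: ltW. Qed.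

Definition colf f : 'cV['F_p]_n := \col_i f i.

Lemma colfE f : (fun i => colf f i 0) = f.
Proof. by apply/funext => i; rewrite mxE. Qed.

(** The second alternative of [packing], with the set T forgotten. *)
Definition bad f := `[< exists U, (n <= 4 * #|U|)%N /\
  forall S, S \subset U -> #|S| = m -> C / p%:R ^+ 2 < disc R (restr (colf f) S) >].

Definition box f J := bohr_ball (weight R f J) (2 * bohr_radius R j).
Definition box0r f S := bohr_ball (weight0r R f S) (2 * bohr_radius R j).

Definition sparse J f := (f != [ffun=> 0]) && [forall i, (i \notin J) ==> (f i == 0)].
Definition boxed J f := [forall i, (i \notin J) ==> (f i \in box f J)] &&
  (#|box f J|%:R * conc R f J <= eps).
(** J certifies that the concentration is O(1/p), while the pair (S, U) locates f: as S avoids U,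
    the box containing f on U depends only on the coordinates outside U. *)
Definition flat J (SU : {set 'I_n} * {set 'I_n}) f :=
  [&& (n <= 5 * #|SU.2|)%N, SU.1 \subset ~: SU.2,
      [forall i in SU.2, f i \in box0r f SU.1],
      #|box0r f SU.1|%:R <= eps * p%:R & conc R f J <= 4 / p%:R].

Let p0 : 0 < p%:R :> R.
Proof. by rewrite ltr0n prime_gt0. Qed.

Lemma bad_cases f : f != [ffun=> 0] -> bad f -> exists J, (#|J| < m)%N &&
  [|| sparse J f, boxed J f | [exists SU, flat J SU f]].
Proof.
move=> f0 /asboolP[U [nU biased]].
have [J [Jm fJ]] := concentrated_rows p_pr hm f.
exists J; rewrite Jm/=.
have in_box : [forall i, (i \notin J) ==> (f i \in box f J)].
  by apply/forallP => i; apply/implyP => /fJ.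
have [W4|W4] := ltP 4 (mass (weight R f J)).
  have [sub|cX] := bohr_ball_dense_card p_pr p_gt2 j W4.
    apply/orP; left; rewrite /sparse f0; apply/forallP => i; apply/implyP => /fJ.
    by move/(fintype.subsetP sub); rewrite inE.
  apply/orP; right; apply/orP; left; rewrite /boxed in_box.
  exact: le_trans cX eps_j.
apply/orP; right; apply/orP; right; apply/existsP.
have mU : (m <= #|U|)%N by lia.
have [S [SU Sm W0 fS]] := biased_coords p_pr p_gt2 hm C1 mU biased.
rewrite colfE in W0 fS.
exists (S, (U :\: S)%SET); apply/and5P; split=> /=.
(* Removing fewer than m <= n/20 points from at least n/4 leaves at least n/5. *)
- have := cardsID S U; have := subset_leq_card (finset.subsetIr U S).
  move: #|S| #|(U :&: S)%SET| #|(U :\: S)%SET| #|U| Sm mU nU => a b c u.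
  by clear -mn; lia.
- by apply/fintype.subsetP => i iS; rewrite !inE iS.
- apply/forall_inP => i; rewrite inE => /andP[iS iU].
  by have := fS i iU iS; rewrite mxE.
- have [sub|cX] := bohr_ball0r_card p_pr p_gt2 j W0.
    apply: le_trans eps_p; rewrite lern1.
    by rewrite (leq_trans (subset_leq_card sub))// cards1.
  apply: le_trans cX _; rewrite mulrC; apply: ler_wpM2r; first exact: ltW.
  apply: le_trans eps_j; rewrite -[leLHS]mul1r ler_wpM2r ?invr_ge0//.
  by rewrite ler1n.
- by rewrite concE mulrC ler_wpM2r ?invr_ge0.
Qed.

Definition orth_event O f : set {ffun upper n -> bool} :=
  [set xi | O \subset orth_rows (shifted_mx lambda xi) (colf f)].

Lemma Pr_orth_event_le O f J :
  Pr R (orth_event O f) <= conc R f J ^+ #|O :\: J|.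
Proof.
by have := Pr_orth_le R p_pr lambda (colf f) O J; rewrite colfE.
Qed.

Lemma conc_ge0 f J : 0 <= conc R f J.
Proof. by apply: le_trans (conc_ge R f J); rewrite invr_ge0. Qed.

Let cardF : #|'F_p|%:R = p%:R :> R. Proof. by rewrite card_Fp. Qed.

(** One nonzero coordinate i gives 3/4 per row of O other than i, hence the predecessor; at most
    p^|J| vectors are supported on J. *)
Lemma sum_sparse O J :
  \sum_(f | sparse J f) Pr R (orth_event O f) <= p%:R ^+ #|J| * (3 / 4) ^+ #|O|.-1.
Proof.
have q0 : 0 <= 3 / 4 :> R by lra.
apply: (@le_trans _ _ (\sum_(f | sparse J f) (3 / 4) ^+ #|O|.-1)).
  apply: ler_sum => f /andP[f0 _].
  have [i fi] : exists i, f i != 0.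
    apply: contrapT => /forallNP h; move/eqP: f0; apply; apply/ffunP => i.
    by rewrite ffunE; have /negP := h i; rewrite negbK => /eqP.
  apply: le_trans (Pr_orth_event_le O f [set i]%SET) _.
  apply: le_trans (_ : (3 / 4) ^+ #|O :\: [set i]| <= _).
    by rewrite lerXn2r ?nnegrE ?conc_ge0// conc1_le.
  rewrite ler_wiXn2l//; first lra.
  by rewrite (cardsD1 i O); case: (i \in O); rewrite /= ?add0n ?leq_pred.
have := @sum_box R _ 'F_p 0 (sparse J) (~: J)%SET (fun=> [set 0]%SET).
rewrite finset.setCK cardF => h.
rewrite sumr_const -[leLHS]mulr_natl ler_wpM2r ?exprn_ge0//.
apply: le_trans (h _ _) => //.
  by under eq_bigr do rewrite cards1 invr1 expr1n; rewrite sumr_const.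
move=> f /andP[_ /forallP fJ] i; rewrite !inE => iJ.
by have := implyP (fJ i) iJ.
Qed.

Lemma cardsCn J : #|~: J|%SET = (n - #|J|)%N.
Proof. by have := cardsC J; rewrite card_ord => h; rewrite -[X in (X - _)%N]h addKn. Qed.

Lemma eq_box f g J : {in J, f =1 g} -> box f J = box g J.
Proof. by move=> fg; rewrite /box (eq_weight _ fg). Qed.

Lemma box_gt0 f J : (0 < #|box f J|)%N.
Proof.
apply/card_gt0P; exists 0; apply: bohr_ball0.
  exact: weight_ge0.
by rewrite mulr_ge0// ltW// bohr_radius_gt0.
Qed.

Lemma box0r_gt0 f J : (0 < #|box0r f J|)%N.
Proof.
apply/card_gt0P; exists 0; apply: bohr_ball0.
  by move=> t; apply: weight0r_ge0.
by rewrite mulr_ge0// ltW// bohr_radius_gt0.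
Qed.

(** Rows outside O are charged at conc >= 1/p, which costs the factor p^|~: O|. Then conc <= eps /
    |box| on the n - |J| coordinates outside J, and [sum_box] absorbs the box sizes. *)
Lemma sum_boxed O J :
  \sum_(f | boxed J f) Pr R (orth_event O f) <=
  p%:R ^+ #|~: O| * eps ^+ (n - #|J|) * p%:R ^+ #|J|.
Proof.
apply: (@le_trans _ _ (\sum_(f | boxed J f)
    p%:R ^+ #|~: O| * eps ^+ (n - #|J|) * (#|box f J|%:R^-1) ^+ #|~: J|)).
  apply: ler_sum => f /andP[_ fc].
  apply: le_trans (Pr_orth_event_le O f J) _.
  rewrite -mulrA -cardsCn -exprMn mulrC -ler_pdivrMr ?exprn_gt0// -exprVn.
  apply: (@le_trans _ _ (conc R f J ^+ #|~: J|)); last first.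
    rewrite lerXn2r ?nnegrE ?conc_ge0 ?mulr_ge0 ?invr_ge0//.
    by rewrite ler_pdivlMr ?ltr0n ?box_gt0// mulrC.
  apply: (@le_trans _ _ (conc R f J ^+ #|O :\: J| * conc R f J ^+ #|~: O|)).
    rewrite ler_wpM2l ?exprn_ge0 ?conc_ge0// lerXn2r ?nnegrE ?conc_ge0 ?invr_ge0//.
    exact: conc_ge.
  rewrite -exprD ler_wiXn2l ?conc_ge0 ?conc_le1//.
  rewrite -(cardsID O (~: J)%SET) leq_add// subset_leq_card//.
    by apply/fintype.subsetP => i; rewrite !inE andbC.
  by apply/fintype.subsetP => i; rewrite !inE => /andP[].
rewrite -mulr_sumr ler_wpM2l ?mulr_ge0 ?exprn_ge0//.
have := @sum_box R _ 'F_p 0 (boxed J) (~: J)%SET (fun f => box f J).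
rewrite finset.setCK cardF; apply.
  by move=> f g fg; apply: eq_box => i iJ; apply: fg; rewrite inE negbK.
by move=> f /andP[/forallP fJ _] i; rewrite inE => /(implyP (fJ i)).
Qed.

(** The factor (eps p / |box|)^|U| >= 1 is inserted so that [sum_box] applies; 4 / p <= 1 lets the
    exponent |O :\: J| be lowered to |O| - |J|. *)
Lemma sum_flat O J SU : (4 <= p)%N ->
  \sum_(f | flat J SU f) Pr R (orth_event O f) <=
  (4 / p%:R) ^+ (#|O| - #|J|) * eps ^+ #|SU.2| * p%:R ^+ n.
Proof.
move=> p4; case: SU => S U.
apply: (@le_trans _ _ (\sum_(f | flat J (S, U) f)
    (4 / p%:R) ^+ (#|O| - #|J|) * (eps * p%:R) ^+ #|U| *
    (#|box0r f S|%:R^-1) ^+ #|U|)).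
  apply: ler_sum => f /and5P[_ _ _ fX fc].
  have fq : 4 / p%:R <= 1 :> R by rewrite ler_pdivrMr// mul1r ler_nat.
  rewrite -mulrA -exprMn -[leLHS]mulr1 ler_pM ?Pr_ge0//.
    apply: le_trans (Pr_orth_event_le O f J) _.
    apply: (@le_trans _ _ ((4 / p%:R) ^+ #|O :\: J|)).
      by rewrite lerXn2r ?nnegrE ?conc_ge0// divr_ge0 ?ltW.
    rewrite ler_wiXn2l// ?divr_ge0//.
    by rewrite cardsD leq_sub2l// subset_leq_card// finset.subsetIr.
  by rewrite exprn_ege1// ler_pdivlMr ?ltr0n ?box0r_gt0// mul1r.
rewrite -mulr_sumr /= -!mulrA ler_wpM2l ?exprn_ge0 ?divr_ge0//.
rewrite exprMn -mulrA ler_wpM2l ?exprn_ge0//.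
have [SU|SU] := boolP (S \subset ~: U)%SET; last first.
  rewrite big_pred0 ?mulr0 ?mulr_ge0 ?exprn_ge0// => f.
  by rewrite /flat/= (negbTE SU) andbF.
have -> : p%:R ^+ n = p%:R ^+ #|U| * p%:R ^+ #|~: U| :> R.
  by rewrite -exprD cardsC card_ord.
rewrite ler_wpM2l ?exprn_ge0// -[p%:R in leRHS]cardF.
apply: (@sum_box R _ 'F_p 0 (flat J (S, U)) U (fun f => box0r f S)).
  move=> f g fg; rewrite /box0r /weight0r (@eq_weight _ _ _ f g)// => i iS.
  by apply: fg; have := fintype.subsetP SU i iS; rewrite inE.
by move=> f /and5P[_ _ /forall_inP fU _ _] i; exact: fU.
Qed.

End BadVectors.

(** * Exponential estimates for a fixed set of orthogonal rows *)

Section Numerics.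
Variable R : realType.

Lemma expRX (a : R) (k : nat) : expR a ^+ k = expR (k%:R * a).
Proof. by rewrite expRM_natl. Qed.

Lemma ler_mul_expR (a b x y : R) : 0 <= a -> 0 <= b ->
  a <= expR x -> b <= expR y -> a * b <= expR (x + y).
Proof. by move=> a0 b0 ax bx; rewrite expRD ler_pM. Qed.

Lemma natr_sub2 (a b c : nat) : (b + c <= a)%N ->
  (a - b - c)%:R = a%:R - b%:R - c%:R :> R.
Proof. by move=> bca; rewrite -subnDA natrB// natrD opprD addrA. Qed.

Lemma two_le_expR1 : 2 <= expR 1 :> R.
Proof. exact: (expR_ge1Dx (1 : R)). Qed.

Lemma two_pow_le (n : nat) : 2 ^+ n <= expR n%:R :> R.
Proof.
by rewrite -[n%:R]mulr1 -expRX lerXn2r ?nnegrE ?expR_ge0// two_le_expR1.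
Qed.

Lemma card_small_sets_expR (I : finType) (q : nat) :
  #|[set O : {set I} | (#|O| <= q)%N]%SET|%:R <= expR (5 * q%:R + #|I|%:R / 32) :> R.
Proof.
have K32 : 32 <= expR 5 :> R.
  rewrite (_ : 32 = 2 ^+ 5); last by rewrite -natrX.
  exact: two_pow_le.
have K1 : 1 <= expR 5 :> R by lra.
apply: le_trans (card_small_sets I q K1) _.
rewrite expRX [leRHS]expRD (mulrC 5). rewrite ler_wpM2l ?expR_ge0//.
rewrite -(expRX _ #|I|) lerXn2r ?nnegrE ?expR_ge0 ?addr_ge0 ?invr_ge0 ?expR_ge0//.
apply: le_trans (expR_ge1Dx _); rewrite lerD2l.
by rewrite lef_pV2 ?posrE ?expR_gt0.
Qed.

Variables (p : nat) (n m j : nat) (lambda : 'F_p) (C l : R).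
Hypotheses (p_pr : prime p) (p_gt2 : (2 < p)%N).
(** On the n/5 coordinates of a flat vector this gains exp (- 8 n), more than is lost to the 4^n
    pairs (S, U) and to the constant 4 in (4 / p)^n. *)
Let eps : R := expR (- 40).
Hypothesis hm : (1 - bohr_radius R j ^+ 2) ^+ m * p%:R ^+ 2 <= 1.
Hypotheses (C1 : 1 <= C) (eps_j : 4 / j.+1%:R <= eps).
Hypotheses (pl : p%:R = expR l) (l_ge : 1000 <= l).
Hypotheses (m_gt0 : (0 < m)%N) (ml : m%:R * l <= n%:R / 1000).

Let m_le : m%:R <= n%:R / 1000 :> R.
Proof.
apply: le_trans ml; rewrite ler_peMr//. have := l_ge; lra.
Qed.

Let m_ge1 : 1 <= m%:R :> R. Proof. by rewrite ler1n. Qed.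

Let mn : (20 * m <= n)%N.
Proof. by rewrite -(ler_nat R) natrM; have := m_le; have := m_ge1; lra. Qed.

Let eps_p : 1 <= eps * p%:R.
Proof. by rewrite pl -expRD -[leLHS]expR0 ler_expR; have := l_ge; lra. Qed.

Let p_ge4 : (4 <= p)%N.
Proof. by rewrite -(ler_nat R) pl; apply: le_trans (expR_ge1Dx _); have := l_ge; lra. Qed.

Lemma sum_bad_orth (O : {set 'I_n}) : #|~: O|%:R * l <= n%:R ->
  \sum_(f | (f != [ffun=> 0]) && bad m C f) Pr R (orth_event lambda O f) <=
  3 * expR (- (n%:R / 5)).
Proof.
set o := #|~: O|%SET => ol; have m1 := m_ge1; have mle := m_le.
have l_lo := l_ge; have ml' := ml.
have o_le : o%:R <= n%:R / 1000 :> R.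
  have : o%:R * 1000 <= o%:R * l by rewrite ler_wpM2l.
  by lra.
have cO : #|O| = (n - o)%N.
  by have := cardsC O; rewrite card_ord => h; rewrite -[X in (X - _)%N]h addnK.
have o1n : (o + 1 <= n)%N by rewrite -(ler_nat R) natrD; lra.
have omn : (o + m <= n)%N by rewrite -(ler_nat R) natrD; lra.
have m_le_n : (m <= n)%N by rewrite -(ler_nat R); lra.
pose Q (f : {ffun 'I_n -> 'F_p}) (J : {set 'I_n}) := (#|J| < m)%N &&
  [|| sparse J f, boxed j eps J f | [exists SU, flat j eps J SU f]].
apply: le_trans (@ler_sum_cover R _ _ _ Q _ _ _) _.
- by move=> f; exact: Pr_ge0.
- by move=> f /andP[f0 fb]; exact: (bad_cases p_pr p_gt2 hm C1 mn (expR_gt0 _) eps_j eps_p f0 fb).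
(* The three terms bound the sparse, boxed and flat vectors of a given J; exp (2 n) counts the pairs
   (S, U). The sparse term is the largest and dictates the final n/5. *)
pose B : R := expR (m%:R * l - (n%:R - o%:R - 1) / 4) +
  expR (o%:R * l + - (40 * (n%:R - m%:R)) + m%:R * l) +
  expR (2 * n%:R + ((2 - l) * (n%:R - o%:R - m%:R) + - (8 * n%:R) + n%:R * l)).
apply: (@le_trans _ _ (\sum_(J in [set J : {set 'I_n} | (#|J| <= m)%N]%SET) B)).
  rewrite [leRHS]big_mkcond; apply: ler_sum => J _; rewrite inE.
  have [Jm|Jm] := ltnP #|J| m; last first.
    rewrite [leLHS]big_pred0 => [|f]; last by rewrite /Q ltnNge Jm.
    by case: ifP => // _; rewrite !addr_ge0 ?expR_ge0.
  rewrite (ltnW Jm).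
  have pJ : p%:R ^+ #|J| <= expR (m%:R * l).
    by rewrite pl expRX ler_expR ler_wpM2r ?ler_nat ?(ltnW Jm)//; lra.
  apply: (@le_trans _ _ (\sum_(f | sparse J f) Pr R (orth_event lambda O f) +
    \sum_(f | boxed j eps J f) Pr R (orth_event lambda O f) +
    \sum_SU \sum_(f | flat j eps J SU f) Pr R (orth_event lambda O f))).
    under [X in _ <= _ + X]eq_bigr do rewrite big_mkcond.
    rewrite exchange_big [leLHS]big_mkcond.
    rewrite [X in _ <= X + _ + _]big_mkcond [X in _ <= _ + X + _]big_mkcond/=.
    rewrite -!big_split/=; apply: ler_sum => f _; rewrite /Q Jm/=.
    have P0 := Pr_ge0 R (orth_event lambda O f).
    have S0 : 0 <= \sum_SU (if flat j eps J SU f then Pr R (orth_event lambda O f) else 0).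
      by apply: sumr_ge0 => SU _; case: ifP.
    have [_|ns] /= := boolP (sparse J f).
      by rewrite -addrA lerDl addr_ge0//; case: ifP.
    have [_|nb] /= := boolP (boxed j eps J f).
      by rewrite add0r lerDl.
    rewrite !add0r; case: ifP => // /existsP[SU fl].
    by rewrite (bigD1 SU)//= fl lerDl sumr_ge0// => SU' _; case: ifP.
  apply: lerD; first apply: lerD.
  - apply: le_trans (sum_sparse R p_pr p_gt2 lambda O J) _.
    have q0 : 0 <= 3 / 4 :> R by lra.
    apply: ler_mul_expR; rewrite ?exprn_ge0//.
    have e : 3 / 4 <= expR (- 4^-1) :> R.
      by apply: le_trans (expR_ge1Dx _); lra.
    apply: (@le_trans _ _ (expR (- 4^-1) ^+ #|O|.-1)).
      by rewrite lerXn2r ?nnegrE ?expR_ge0//; lra.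
    rewrite expRX ler_expR cO -subn1 natr_sub2//; lra.
  - apply: le_trans (sum_boxed p_pr j lambda (expR_gt0 _) O J) _.
    apply: ler_mul_expR; rewrite ?mulr_ge0 ?exprn_ge0 ?expR_ge0//.
    apply: ler_mul_expR; rewrite ?mulr_ge0 ?exprn_ge0 ?expR_ge0//.
      by rewrite pl expRX.
    rewrite expRX ler_expR.
    have nJ : n%:R - m%:R <= (n - #|J|)%:R :> R.
      by rewrite -natrB// ler_nat leq_sub2l// ltnW.
    by lra.
  - have fq : 4 / p%:R <= expR (2 - l).
      rewrite pl -expRN; apply: ler_mul_expR; rewrite ?expR_ge0//.
      rewrite (_ : 4 = 2 ^+ 2); last by rewrite -natrX.
      exact: two_pow_le.
    set x := (2 - l) * _ + _ + _.
    have step SU : \sum_(f | flat j eps J SU f) Pr R (orth_event lambda O f) <= expR x.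
      have [nU|nU] := leqP n (5 * #|SU.2|); last first.
        rewrite big_pred0 ?expR_ge0// => f; rewrite /flat leqNgt nU//.
      apply: le_trans (sum_flat p_pr j lambda (expR_gt0 _) O J SU p_ge4) _.
      apply: ler_mul_expR; rewrite ?mulr_ge0 ?exprn_ge0 ?divr_ge0 ?expR_ge0//.
      apply: ler_mul_expR; rewrite ?exprn_ge0 ?divr_ge0 ?expR_ge0//.
      + apply: (@le_trans _ _ (expR (2 - l) ^+ (#|O| - #|J|))).
          by rewrite lerXn2r ?nnegrE ?divr_ge0 ?expR_ge0.
        rewrite expRX ler_expR mulrC ler_wnM2l//; first lra.
        by rewrite cO -natr_sub2// ler_nat leq_sub2l// ltnW.
      + rewrite expRX ler_expR.
        have : n%:R <= 5 * #|SU.2|%:R :> R by rewrite -natrM ler_nat.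
        by lra.
      + by rewrite pl expRX.
    apply: (@le_trans _ _ (\sum_(SU : {set 'I_n} * {set 'I_n}) expR x)).
      by apply: ler_sum => SU _; exact: step.
    rewrite sumr_const card_prod -cardsT -finset.powersetT card_powerset.
    rewrite cardsT card_ord -[leLHS]mulr_natl.
    apply: ler_mul_expR; rewrite ?expR_ge0//.
    rewrite -expnD addnn -muln2 mulnC natrX.
    by rewrite -natrM; apply: two_pow_le.
rewrite sumr_const -[leLHS]mulr_natl.
have B0 : 0 <= B by rewrite !addr_ge0 ?expR_ge0.
apply: le_trans (ler_wpM2r B0 (card_small_sets_expR _ m)) _.
rewrite card_ord /B !mulrDr -!expRD.
rewrite (_ : 3 = 1 + 1 + 1); last by ring.
rewrite !mulrDl !mul1r !lerD// ler_expR; have := ler0n R o; lra.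
Qed.

End Numerics.

(** * Union bound over row sets and bad vectors *)

Section Assembly.
Variables (R : realType) (p n m : nat) (lambda : 'F_p) (C : R).
Hypothesis p_pr : prime p.

Definition good (xi : {ffun upper n -> bool}) : Prop :=
  forall v : 'cV['F_p]_n, v != 0 ->
    n%:R - n%:R / ln p%:R <= #|orth_rows (shifted_mx lambda xi) v|%:R :> R ->
    forall T : {set 'I_n}, #|T| = (n %/ 4)%N ->
      exists F : {set {set 'I_n}},
        [/\ finset.trivIset F, n%:R / (2 * m%:R) <= #|F|%:R :> R
          & forall S : {set 'I_n}, S \in F ->
              [/\ S \subset ~: T, #|S| = m & disc R (restr v S) <= C / p%:R ^+ 2]].

Lemma not_good xi : (0 < m)%N -> ~ good xi ->
  exists f : {ffun 'I_n -> 'F_p}, [/\ f != [ffun=> 0], bad m C f &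
    n%:R - n%:R / ln p%:R <= #|orth_rows (shifted_mx lambda xi) (colf f)|%:R :> R].
Proof.
move=> m0 ng; apply: contrapT => nf; apply: ng => v v0 vO T cT.
pose f : {ffun 'I_n -> 'F_p} := [ffun i => v i 0].
have fv : colf f = v by apply/matrixP => i k; rewrite !mxE ffunE ord1.
have [[F [Ft Fn Fg]]|[U [nU Ug]]] :=
  @packing n m (fun S => `[< disc R (restr v S) <= C / p%:R ^+ 2 >]) T m0 cT.
  exists F; split=> //.
    by rewrite ler_pdivrMr ?mulr_gt0 ?ltr0n// -!natrM ler_nat.
  by move=> S /Fg[? ? /asboolP ?]; split.
exfalso; apply: nf; exists f; rewrite fv; split=> //.
  apply: contra_neq v0 => f0; rewrite -fv f0.
  by apply/matrixP => i k; rewrite !mxE ffunE.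
apply/asboolP; exists U; split=> // S SU Sm; rewrite fv ltNge.
by have := Ug S SU Sm; apply: contraNN => h; apply/asboolP.
Qed.

(** When C / p^2 >= 1 the discrepancy bound is trivial, so any m-subset of U contradicts badness. *)
Lemma good_of_large_C xi : (0 < m)%N -> (4 * m <= n)%N -> p%:R ^+ 2 <= C -> good xi.
Proof.
move=> m0 mn pC; apply: contrapT => /(not_good m0)[f [_ /asboolP[U [nU Uf]] _]].
have mU : (m <= #|U|)%N by rewrite -(leq_pmul2l (_ : 0 < 4)%N)// (leq_trans mn).
have /card_geqP[s [us ss sU]] := mU.
pose S : {set 'I_n} := [set i in s]%SET.
have SU : S \subset U by apply/fintype.subsetP => i; rewrite inE => /sU.
have Sm : #|S| = m by rewrite cardsE (card_uniqP us).
have := Uf S SU Sm; rewrite ltNge => /negP; apply.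
apply: le_trans (disc_le1 R p_pr _) _.
by rewrite ler_pdivlMr ?mul1r// exprn_gt0// ltr0n prime_gt0.
Qed.

Lemma Pr_good_ge (j : nat) (l : R) : (2 < p)%N -> (0 < m)%N ->
  (1 - bohr_radius R j ^+ 2) ^+ m * p%:R ^+ 2 <= 1 -> 1 <= C ->
  4 / j.+1%:R <= expR (- 40) :> R -> p%:R = expR l -> 1000 <= l ->
  m%:R * l <= n%:R / 1000 ->
  1 - expR (- (n%:R / 9)) <= Pr R [set xi | good xi].
Proof.
move=> p2 m0 hm C1 eps_j pl l_ge ml.
have l0 : 0 < l by lra.
have n_ge : 1000 <= n%:R :> R.
  have : 1 * l <= m%:R * l by rewrite ler_wpM2r ?ler1n// ltW.
  by lra.
rewrite lerBlDr -[leLHS](Pr_setC R [set xi | good xi]) lerD2l.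
pose P (a : {set 'I_n} * {ffun 'I_n -> 'F_p}) :=
  (#|~: a.1|%:R * l <= n%:R) && ((a.2 != [ffun=> 0]) && bad m C a.2).
apply: le_trans (@Pr_le_sum R _ _ P (~` [set xi | good xi])
  (fun a => orth_event lambda a.1 a.2) _) _.
  move=> xi /(not_good m0)[f [f0 fb fO]].
  (* O is taken to be the full set of rows orthogonal to f, so it misses at most n / l rows. *)
  exists (orth_rows (shifted_mx lambda xi) (colf f), f) => /=; last exact: fintype.subxx.
  rewrite /P f0 fb/= andbT cardsCn natrB; last first.
    by rewrite -[leqRHS](card_ord n) max_card.
  by rewrite -ler_pdivlMr// lerBlDl -lerBlDr; move: fO; rewrite pl expRK.
apply: (@le_trans _ _ (\sum_(O : {set 'I_n} | #|~: O|%:R * l <= n%:R)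
    \sum_(f | (f != [ffun=> 0]) && bad m C f) Pr R (orth_event lambda O f))).
  rewrite [leRHS]pair_big_dep/=; rewrite le_eqVlt; apply/orP; left; apply/eqP.
  exact: eq_bigl.
apply: (@le_trans _ _ (\sum_(O : {set 'I_n} | #|~: O|%:R * l <= n%:R)
    3 * expR (- (n%:R / 5)))).
  by apply: ler_sum => O hO; exact: (sum_bad_orth lambda p_pr p2 hm C1 eps_j pl l_ge m0 ml hO).
pose q := Num.trunc (n%:R / l : R).
have nl0 : 0 <= n%:R / l by rewrite divr_ge0// ltW.
have q_le : q%:R <= n%:R / 1000 :> R.
  apply: (@le_trans _ _ (n%:R / l)); first by rewrite truncn_le.
  by rewrite ler_wpM2l// lef_pV2// posrE; lra.
rewrite (reindex_inj (inv_inj (@finset.setCK _)))/=.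
apply: (@le_trans _ _ (\sum_(O in [set O : {set 'I_n} | (#|O| <= q)%N]%SET)
    3 * expR (- (n%:R / 5)))).
  rewrite le_eqVlt; apply/orP; left; apply/eqP; apply: eq_bigl => O.
  by rewrite finset.setCK inE truncn_ge_nat// ler_pdivlMr.
rewrite sumr_const -[leLHS]mulr_natl.
have := card_small_sets_expR R 'I_n q; rewrite card_ord => hq.
(* As n >= 1000, the factor 3 is at most exp (n / 500); with q <= n / 1000 the total exponent stays
   below - n/9. *)
apply: (@le_trans _ _ (expR (5 * q%:R + n%:R / 32) * (expR (n%:R / 500) * expR (- (n%:R / 5))))).
  rewrite ler_pM ?mulr_ge0 ?expR_ge0// ler_wpM2r ?expR_ge0//.
  by apply: le_trans (expR_ge1Dx _); lra.
by rewrite -!expRD ler_expR; lra.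
Qed.

End Assembly.

(** * Choice of the constants and conclusion *)

Section Constants.
Variable R : realType.

Lemma ln_ge_half (x : R) : 3 <= x -> 2^-1 <= ln x.
Proof.
move=> x3; have x0 : 0 < x by lra.
rewrite -ler_expR lnK ?posrE//; apply: le_trans x3.
have e : expR (- 2^-1) * expR 2^-1 = 1 :> R by rewrite -expRD addNr expR0.
have := ler_wpM2r (expR_ge0 2^-1) (expR_ge1Dx (- 2^-1 : R)).
by rewrite e; have := expR_gt0 (2^-1 : R); lra.
Qed.

(** The form in which the bound on p is applied: m * ln p is of order C (ln p)^2, which must be
    small against n. *)
Lemma sqr_ln_le (n : nat) (c x : R) : (0 < n)%N -> 0 < c -> 1 <= x ->
  x <= expR (c * n%:R `^ 4^-1) -> ln x ^+ 2 <= c * c * n%:R.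
Proof.
move=> n0 c0 x1 xc; have x0 : 0 < x by apply: lt_le_trans x1.
set y := n%:R `^ 4^-1 in xc.
have y4 : y ^+ 4 = n%:R.
  by rewrite -powR_mulrn ?powR_ge0// -powRrM mulVf// powRr1.
have y0 : 0 <= y by exact: powR_ge0.
have y1 : 1 <= y by rewrite -(@ler_pXn2r _ 4) ?nnegrE// expr1n y4 ler1n.
have y2 : y ^+ 2 <= n%:R.
  rewrite -y4 (_ : y ^+ 4 = y ^+ 2 * y ^+ 2); last by rewrite -exprD.
  by rewrite ler_peMr ?exprn_ge0// exprn_ege1.
have lxy : ln x <= c * y by rewrite -ler_expR lnK.
apply: (@le_trans _ _ ((c * y) ^+ 2)).
  by rewrite lerXn2r ?nnegrE ?mulr_ge0 ?ln_ge0// ltW.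
rewrite exprMn expr2; apply: ler_wpM2l => //.
by rewrite mulr_ge0// ltW.
Qed.

Lemma absz_ceil_itv (a : R) : 2^-1 <= a ->
  a <= `|Num.ceil a|%N%:R /\ `|Num.ceil a|%N%:R <= 3 * a.
Proof.
move=> a_half; have a0 : 0 <= a by lra.
rewrite natr_absz ger0_norm; last by rewrite -(ler_int R) (le_trans a0)// ceil_ge.
split; first exact: ceil_ge.
by have := @ceilB1_lt R a; rewrite rmorphB/=; lra.
Qed.

(** First j from eps, then C from tau, then c from C. The bound C >= 2 / tau^2 makes (1 - tau^2)^m
    beat p^2, and C >= exp 2000 forces ln p > 1000 once p^2 > C. *)
Lemma exists_constants : exists (j : nat) (c C : R),
  [/\ 4 / j.+1%:R <= expR (- 40) :> R, 2 <= C * bohr_radius R j ^+ 2,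
      1 <= C /\ expR 2000 <= C, 0 < c <= 1 & 6000 * (C * c) <= 1].
Proof.
have e0 := @expR_gt0 R (- 40).
have b0 : 0 <= 4 / expR (- 40) :> R by rewrite divr_ge0// ltW.
pose j := Num.Def.archi_bound (4 / expR (- 40) : R).
have eps_j : 4 / j.+1%:R <= expR (- 40) :> R.
  rewrite ler_pdivrMr ?ltr0n// mulrC -ler_pdivrMr//.
  by apply: le_trans (ltW (archi_boundP b0)) _; rewrite ler_nat leqnSn.
have rho2 : 0 < bohr_radius R j ^+ 2 by rewrite exprn_gt0// bohr_radius_gt0.
pose C : R := 2 / bohr_radius R j ^+ 2 + expR 2000.
have C_rho : 2 <= C * bohr_radius R j ^+ 2.
  by rewrite -ler_pdivrMr// lerDl expR_ge0.
have C_exp : expR 2000 <= C by rewrite lerDr divr_ge0// ltW.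
have C1 : 1 <= C by have := expR_ge1Dx (2000 : R); lra.
have [D D_ge] : exists D : R, 6000 * C <= D by exists (6000 * C).
have D1 : 1 <= D by lra.
have D0 : 0 < D by apply: lt_le_trans D1.
exists j, D^-1, C; split.
- exact: eps_j.
- exact: C_rho.
- by split; [exact: C1|exact: C_exp].
- by rewrite invr_gt0 D0 invf_le1.
- by rewrite mulrA (ler_pdivrMr _ _ D0) mul1r; exact: D_ge.
Qed.

End Constants.

Theorem proposition2p5 (R : realType) :
  exists c C : R, 0 < c /\ 1 <= C /\
  forall (n p : nat) (lambda : 'F_p),
    (0 < n)%N -> prime p -> (2 < p)%N ->
    p%:R <= expR (c * n%:R `^ 4^-1) ->
    let m := `|Num.ceil (C * ln p%:R)|%N in
    1 - expR (- (n%:R / 9)) <=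
    Pr R [set xi : {ffun upper n -> bool} |
      let A := map_mx (intr : int -> 'F_p) (sym_rademacher_mx xi)
               - lambda%:M in
      forall v : 'cV['F_p]_n,
        v != 0 ->
        n%:R - n%:R / ln p%:R <= #|orth_rows A v|%:R :> R ->
        forall T : {set 'I_n},
          #|T| = (n %/ 4)%N ->
          exists F : {set {set 'I_n}},
            [/\ finset.trivIset F,
                n%:R / (2 * m%:R) <= #|F|%:R :> R
              & forall S : {set 'I_n}, S \in F ->
                  [/\ S \subset ~: T, #|S| = m
                    & disc R (restr v S) <= C / p%:R ^+ 2]]].
Proof.
have [j [c [C [eps_j C_rho [C1 C_exp] /andP[c0 c1] cC]]]] := exists_constants R.
exists c, C; split=> //; split=> // n p lambda n0 p_pr p2 pc.
pose m := `|Num.ceil (C * ln p%:R)|%N.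
suff : 1 - expR (- (n%:R / 9)) <= 
  Pr R [set xi : {ffun upper n -> bool} | good m lambda C xi] by [].
have p0 : 0 < p%:R :> R by rewrite ltr0n prime_gt0.
have l_half : 2^-1 <= ln (p%:R : R) by apply: ln_ge_half; rewrite (ler_nat R 3).
have p1 : 1 <= p%:R :> R by rewrite ler1n prime_gt0.
have l2 := sqr_ln_le n0 c0 p1 pc.
have pl : p%:R = expR (ln (p%:R : R)) by rewrite lnK.
have [m_lo m_hi] : C * ln p%:R <= m%:R /\ m%:R <= 3 * (C * ln p%:R).
  by apply: absz_ceil_itv; rewrite -[leLHS]mul1r ler_pM.
move: (ln (p%:R : R)) l_half l2 pl m_lo m_hi => l l_half l2 pl m_lo m_hi.
clearbody m.
have C0 : 0 < C by apply: lt_le_trans C1.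
have l0 : 0 < l by apply: lt_le_trans l_half; rewrite invr_gt0.
have m0 : (0 < m)%N by rewrite -(ltr0n R); apply: lt_le_trans m_lo; rewrite mulr_gt0.
have cn : 0 <= c * n%:R by rewrite mulr_ge0// ltW.
have ml : m%:R * l <= n%:R / 1000.
  have h1 : m%:R * l <= 3 * (C * l) * l by rewrite ler_wpM2r// ltW.
  have h2 : C * l ^+ 2 <= C * (c * c * n%:R) by rewrite ler_wpM2l// ltW.
  have h3 : 6000 * (C * c) * (c * n%:R) <= 1 * (c * n%:R) by exact: ler_wpM2r.
  have h4 : c * n%:R <= 1 * n%:R by rewrite ler_wpM2r.
  have n0' : 0 <= n%:R :> R by [].
  by clear -h1 h2 h3 h4 n0'; lra.
clear cC cn c0 c1 l2 pc.
(* For p^2 <= C every outcome is good; otherwise p is large enough for [Pr_good_ge]. *)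
have [pC|pC] := leP (p%:R ^+ 2 : R) C.
  have mn : (4 * m <= n)%N.
    rewrite -(ler_nat R) natrM.
    have h1 : m%:R * 2^-1 <= m%:R * l :> R by rewrite ler_wpM2l.
    have n0' : 0 <= n%:R :> R by [].
    by clear -h1 n0' ml; lra.
  rewrite PrE (_ : \sum_xi _ = \sum_(xi : {ffun upper n -> bool}) 1); last first.
    apply: eq_bigr => xi _; rewrite mem_set//.
    exact: (good_of_large_C p_pr m0 mn pC).
  by rewrite sum_coins lerBlDr lerDl expR_ge0.
have l_ge : 1000 <= l.
  have : expR 2000 < expR (2%:R * l) by rewrite -expRX -pl (le_lt_trans C_exp).
  by rewrite ltr_expR; clear; lra.
apply: (@Pr_good_ge R p n m lambda C p_pr j l p2 m0) => //.
clear C_exp l_ge ml eps_j.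
set rho := bohr_radius R j in C_rho *.
have q0 : 0 <= 1 - rho ^+ 2 := subr_sqr_bohr_radius_ge0 R j.
(* The exponent 2 l - m tau^2 is nonpositive, since m >= C l and C tau^2 >= 2. *)
apply: (@le_trans _ _ (expR (- rho ^+ 2) ^+ m * expR l ^+ 2)).
  rewrite pl ler_wpM2r ?exprn_ge0 ?expR_ge0// lerXn2r ?nnegrE ?expR_ge0//.
  exact: (expR_ge1Dx (- rho ^+ 2)).
rewrite !expRX -expRD -[leRHS]expR0 ler_expR.
have h1 : C * l * rho ^+ 2 <= m%:R * rho ^+ 2.
  by rewrite ler_wpM2r// exprn_ge0// ltW// bohr_radius_gt0.
have h2 : 2 * l <= C * rho ^+ 2 * l by rewrite ler_wpM2r// ltW.
by clear -h1 h2; lra.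
Qed.
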